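(* Let $I=[0,1]$, let $\{B(s):s\in I\}$ be a standard Brownian motion on a complete probability space $(\Omega,\mathcal F,\mathbb P)$, and let $\{A(s):s\in I\}$ be a stochastic process with continuous paths, adapted to the natural filtration of $B$, with values in $[\underline a,\overline a]$ where $\frac12<\underline a\le\overline a<1$ are deterministic constants. Assume that there are constants $c>0$ and $\rho\in(0,1]$ such that $\mathbb E(|A(x)-A(y)|^2)\le c|x-y|^{2\rho}$ for all $x,y\in I$. Assume moreover that there are a deterministic constant $\gamma\in(\frac12,1)$ and an event $\Omega_0$ of probability $1$ such that, for each $\omega\in\Omega_0$, there is a finite constant $C_1(\omega)$ with $$|A(s'',\omega)-A(s',\omega)|\le C_1(\omega)|s''-s'|^\gamma\qquad\text{for all }s',s''\in I.$$ Let $\{X(t):t\in I\}$ be the continuous modification of the process given by the Itô integrals $X(t)=\int_0^1(t-s)_+^{A(s)-1/2}\,dB(s)$. Then there exists an event $\Omega_1\subseteq\Omega$ of probability $1$ such that, for every $\omega\in\Omega_1$ and for all non-degenerate compact intervals $[\nu_1,\nu_2]\subseteq I$, $$\beta_{X(\cdot,\omega)}\big([\nu_1,\nu_2]\big)\ \ge\ \min\{A(s,\omega):s\in[\nu_1,\nu_2]\}.$$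
   Context: The natural filtration of $B$ is $\mathcal F_s=\sigma(B(u);0\le u\le s)$, $s\in I$. $(t-s)_+^{A(s)-1/2}$ means $0$ if $t\le s$ and $(t-s)^{A(s)-1/2}$ otherwise. The process $X$ has a modification with Hölder continuous paths on $I$, and $X$ always denotes this modification. For a continuous function $f:I\to\mathbb R$ and a non-degenerate compact interval $[\nu_1,\nu_2]\subseteq I$, the uniform Hölder exponent of $f$ on $[\nu_1,\nu_2]$ is $$\beta_f\big([\nu_1,\nu_2]\big):=\sup\Big\{\gamma\in[0,1]:\ \sup_{t',t''\in[\nu_1,\nu_2],\,t'\ne t''}\frac{|f(t'')-f(t')|}{|t''-t'|^\gamma}<+\infty\Big\}.$$ *)

(* Defs.v *)
From HB Require Import structures.
From mathcomp Require Import all_boot all_order all_algebra.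
From mathcomp Require Import all_classical all_reals all_analysis.

Set Implicit Arguments.
Unset Strict Implicit.
Unset Printing Implicit Defensive.

Import Order.TTheory GRing.Theory Num.Theory.
Import numFieldNormedType.Exports.

Local Open Scope classical_set_scope.
Local Open Scope ring_scope.

Section Brownian.
Context {d : measure_display} {Omega : measurableType d} {R : realType}.
Variable P : probability Omega R.

(* Processes on I = [0, 1] are indexed by R; only the indices in [0, 1] ever
   matter. *)

(* The events {B(u) \in C} with 0 <= u <= s, which generate the raw (not
   augmented) natural filtration of B at time s. *)
Definition past_events (B : R -> {RV P >-> R}) (s : R) : set (set Omega) :=
  \bigcup_(u in `[0, s]) preimage_set_system setT (B u) measurable.

Definition natural_filtration (B : R -> {RV P >-> R}) (s : R) : set (set Omega) :=
  <<s past_events B s >>.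

Definition filtration_measurable (B : R -> {RV P >-> R}) (s : R) (f : Omega -> R) :=
  measurable_fun [set: g_sigma_algebraType (past_events B s)] f.

Definition adapted (B : R -> {RV P >-> R}) (H : R -> Omega -> R) :=
  forall s, s \in `[0, 1] -> filtration_measurable B s (H s).

(* [normal_prob m sigma] has standard deviation sigma. *)
Record standard_brownian_motion (B : R -> {RV P >-> R}) : Prop := {
  bm_start : {ae P, forall w, B 0 w = 0} ;
  bm_continuous : {ae P, forall w, {within `[0, 1], continuous (fun t : R => B t w)}} ;
  bm_gaussian : forall s t : R, 0 <= s -> s < t -> t <= 1 ->
    forall C : set R, measurable C ->
      pushforward P (B t \- B s) C = normal_prob 0 (Num.sqrt (t - s)) C ;
  bm_independent : forall s t : R, 0 <= s -> s < t -> t <= 1 ->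
    forall (E : set Omega) (C : set R),
      natural_filtration B s E -> measurable C ->
      P (E `&` (B t \- B s) @^-1` C) = (P E * P ((B t \- B s)%R @^-1` C))%E
}.

(* The process  \sum_(i < n) xi_i 1_]t_i, t_(i+1)]  with xi_i bounded and
   F_(t_i)-measurable. *)
Record simple_process (B : R -> {RV P >-> R}) := SimpleProcess {
  sp_size : nat ;
  sp_time : nat -> R ;
  sp_coef : nat -> Omega -> R ;
  sp_time_unit : forall i, (i <= sp_size)%N -> sp_time i \in `[0, 1] ;
  sp_time_incr : forall i, (i < sp_size)%N -> sp_time i < sp_time i.+1 ;
  sp_coef_bounded : forall i, (i < sp_size)%N ->
    exists M : R, forall w, `|sp_coef i w| <= M ;
  sp_coef_measurable : forall i, (i < sp_size)%N ->
    filtration_measurable B (sp_time i) (sp_coef i)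
}.

Definition sp_eval (B : R -> {RV P >-> R}) (h : simple_process B) (s : R) (w : Omega) : R :=
  \sum_(i < sp_size h)
    sp_coef h i w * \1_(`]sp_time h i, sp_time h i.+1]) s.

Definition sp_integral (B : R -> {RV P >-> R}) (h : simple_process B) (w : Omega) : R :=
  \sum_(i < sp_size h)
    sp_coef h i w * (B (sp_time h i.+1) w - B (sp_time h i) w).

(* Y is a version of  \int_0^1 H(s) dB(s): the L^2(P) limit of the integrals of
   simple processes that approximate the measurable adapted integrand H in
   L^2(P (x) ds).  By the Ito isometry Y is unique up to almost sure equality
   and does not depend on the approximating sequence. *)
Definition is_ito_integral (B : R -> {RV P >-> R}) (H : R -> Omega -> R)
    (Y : {RV P >-> R}) : Prop :=
  [/\ measurable_fun ((`[0, 1]%classic : set R) `*` [set: Omega])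
        (fun z : R * Omega => H z.1 z.2),
      adapted B H &
      exists h : nat -> simple_process B,
        (fun n => \int[P]_w \int[lebesgue_measure]_(s in `[0%R, 1%R])
                    ((sp_eval (h n) s w - H s w) ^+ 2)%:E)%E @ \oo --> 0%E
        /\ (fun n => 'E_P[fun w => ((sp_integral (h n) w - Y w) ^+ 2)%R])%E
             @ \oo --> 0%E].

End Brownian.

(* (x)_+^p, which is 0 for x <= 0 even when p <= 0. *)
Definition pos_powR {R : realType} (x p : R) : R :=
  if x <= 0 then 0 else x `^ p.

Definition holder_exponent {R : realType} (f : R -> R) (nu1 nu2 : R) : R :=
  sup [set g : R | 0 <= g <= 1 /\
    (ereal_sup [set q : \bar R | exists t' t'' : R,
       [/\ t' \in `[nu1, nu2], t'' \in `[nu1, nu2], t' != t'' &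
           q = (`|f t'' - f t'| / `|t'' - t'| `^ g)%:E]] < +oo)%E].

(* Main.v *)
Require Import Defs.
From HB Require Import structures.
From mathcomp Require Import all_boot all_order all_algebra.
From mathcomp Require Import all_classical all_reals all_analysis.
From mathcomp Require Import measurable_realfun.
From mathcomp Require Import ring lra.

Import Order.TTheory GRing.Theory Num.Theory.
Import numFieldNormedType.Exports.

Local Open Scope classical_set_scope.
Local Open Scope ring_scope.

Set Implicit Arguments.
Unset Strict Implicit.
Unset Printing Implicit Defensive.

(** For [t1 < t2], the increment [X t2 - X t1] is the Ito integral of
    [f(s) = (t2 - s)_+^(A(s) - 1/2) - (t1 - s)_+^(A(s) - 1/2)].  The exponential
    martingale of a simple process gives the Gaussian bound
    [P(|X t2 - X t1| >= x, int f^2 <= y) <= 2 exp(- x^2 / (72 y))], which passes to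
    the L^2 limit by Markov's inequality because it only involves the energy
    [int f^2] of the integrand.  If [A >= a > b] on [[t1 - delta, t2]], then
    [int f^2 <= C (t2 - t1)^(2b)] pathwise, with [C] depending on [a, b, delta] only.
    By Borel-Cantelli over dyadic neighbours and over countably many [(beta, b, C)]
    with [beta < b], almost surely all small dyadic increments whose energy is below
    [C 2^(-2bn)] are at most [2^(-beta n)]; chaining turns this into
    beta-Hoelder continuity on every interval where [min A > b]. *)

(** * The law of a Brownian increment given the past *)

(** The exponent of the kernel is random, so an increment of [X] need not be Gaussian and its energy
    is itself a random variable: there is no deterministic variance to estimate. This is why the
    tail bound concerns the joint event of a large increment and a small energy, and why the energy
    is then bounded path by path. Two strict inequalities between exponents carry the argument. The
    gap [beta < b] makes [2 ^ n * exp (- c * 2 ^ (2 * (b - beta) * n))] summable. The gap [b < a]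
    makes the singularity [(t - s) ^ (2 * (a - b) - 1)] integrable. The lower bound on [A] is asked
    only slightly to the left of [t1], because farther back the kernel is smooth in [t] and its
    squared increment is at most [(t2 - t1) ^ 2 / delta ^ 2]. The interval, the minimum of [A] on it
    and [C] all depend on the path; they are replaced by rational and integer parameters so that one
    null set serves every interval. *)

Section density.
Import HBNNSimple.

(** On a level set of a simple function the formula is the hypothesis on [nu]; linearity and
    monotone convergence do the rest. It turns integrals against a normal law into Lebesgue
    integrals. *)
Lemma ge0_integral_density {d} {T : measurableType d} {R : realType}
    (mu nu : {measure set T -> \bar R}) (g : T -> R) (f : T -> \bar R) :
  measurable_fun setT g -> (forall x, 0 <= g x) ->
  (forall V, measurable V -> nu V = \int[mu]_(x in V) (g x)%:E)%E ->
  measurable_fun setT f -> (forall x, 0 <= f x)%E ->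
  (\int[nu]_x f x = \int[mu]_x (f x * (g x)%:E))%E.
Proof.
move=> mg g0 nuE mf f0.
have density_nnsfun (h : {nnsfun T >-> R}) :
    (\int[nu]_x (h x)%:E = \int[mu]_x ((h x)%:E * (g x)%:E))%E.
  under [LHS]eq_integral do rewrite fimfunE -fsumEFin//.
  rewrite [LHS]ge0_integral_fsum//; last 2 first.
    - by move=> r; exact/measurable_EFinP/measurableT_comp.
    - by move=> n x _; rewrite EFinM nnfun_muleindic_ge0.
  under [RHS]eq_integral.
    move=> x xD; rewrite fimfunE -fsumEFin// ge0_mule_fsuml; last first.
      by move=> r; rewrite EFinM nnfun_muleindic_ge0.
    over.
  rewrite [RHS]ge0_integral_fsum//; last 2 first.
    - move=> r; apply: emeasurable_funM; last exact/measurable_EFinP.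
      by apply/measurable_EFinP; apply/measurableT_comp.
    - by move=> n x _; apply: mule_ge0; rewrite ?lee_fin ?g0//;
        rewrite -lee_fin EFinM nnfun_muleindic_ge0.
  apply: eq_fsbigr => r _; have [r0|r0] := ltP r 0.
    rewrite preimage_nnfun0//.
    by rewrite !integral0_eq// => x _; rewrite indic0 mulr0 ?mul0e.
  rewrite integralZl_indic_nnsfun// integral_indic// setIT.
  under [RHS]eq_integral do rewrite EFinM -muleA.
  rewrite ge0_integralZl//=; last 2 first.
    - apply: emeasurable_funM; last exact/measurable_EFinP.
      exact/measurable_EFinP.
    - by move=> x _; rewrite mule_ge0// lee_fin.
  congr (_ * _)%E; rewrite nuE// integral_mkcond; apply: eq_integral => x _.
  by rewrite patchE indicE; case: ifPn => _; rewrite ?mul1e ?mul0e.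
pose f_ := nnsfun_approx measurableT mf.
transitivity (limn (fun n => \int[nu]_x (f_ n x)%:E))%E.
  rewrite -monotone_convergence//=.
  - apply: eq_integral => x /[!inE] xD; apply/esym/cvg_lim => //=.
    exact: cvg_nnsfun_approx.
  - by move=> n; exact/measurable_EFinP.
  - by move=> n x _; rewrite lee_fin.
  - by move=> x _ a b ab; rewrite lee_fin; exact/lefP/nd_nnsfun_approx.
rewrite [X in limn X](_ : _ =
    (fun n => \int[mu]_x ((f_ n x)%:E * (g x)%:E)))%E; last first.
  by apply/funext => n; rewrite density_nnsfun.
rewrite -monotone_convergence//=.
- apply: eq_integral => x _; apply/cvg_lim => //.
  apply: cvgeZr => //.
  exact: cvg_nnsfun_approx.
- move=> n; apply: emeasurable_funM; exact/measurable_EFinP.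
- by move=> n x _; rewrite mule_ge0// lee_fin.
- move=> x _ a b ab; rewrite lee_pmul// ?lee_fin//.
  by exact/lefP/nd_nnsfun_approx.
Qed.

End density.

(** Completing the square: this exponential times the centred normal density is the normal density
    with mean [theta * sigma ^+ 2], of total mass 1. *)
Lemma integral_normal_prob_exp {R : realType} (sigma theta : R) : sigma != 0 ->
  (\int[normal_prob 0 sigma]_z
     (expR (theta * z - theta ^+ 2 * sigma ^+ 2 / 2))%:E = 1)%E.
Proof.
move=> s0.
rewrite (@ge0_integral_density _ _ _ lebesgue_measure _ (normal_pdf 0 sigma))//=.
- rewrite -[RHS](integral_normal_pdf (theta * sigma ^+ 2) sigma).
  apply: eq_integral => z _; rewrite -EFinM !normal_pdfE// mulrCA; congr EFin.
  rewrite /= /normal_fun -expRD; congr (_ * expR _).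
  by field.
- exact: measurable_normal_pdf.
- by move=> x; exact: normal_pdf_ge0.
- apply/measurable_EFinP; apply: measurableT_comp => //.
  apply: measurable_funB => //; exact: measurable_funM.
Qed.

(** The hypothesis says that the law of [(U, V)] agrees with a product measure on rectangles, hence
    everywhere; Tonelli then separates the variables. *)
Lemma ge0_integral_independent {d d1 d2} {Omega : measurableType d}
    {T1 : measurableType d1} {T2 : measurableType d2} {R : realType}
    (P : probability Omega R) (U : {mfun Omega >-> T1})
    (V : {mfun Omega >-> T2}) (nu : probability T2 R)
    (psi : T1 * T2 -> \bar R) :
  (forall A C, measurable A -> measurable C ->
    P (U @^-1` A `&` V @^-1` C) = P (U @^-1` A) * nu C)%E ->
  measurable_fun setT psi -> (forall x, 0 <= psi x)%E ->
  (\int[P]_w psi (U w, V w) = \int[P]_w \int[nu]_z psi (U w, z))%E.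
Proof.
move=> indep mpsi psi0.
have mUV : measurable_fun setT (fun w => (U w, V w)).
  by apply: measurable_fun_pair; exact: measurable_funP.
pose UV : {mfun Omega >-> (T1 * T2)%type} :=
  HB.pack (fun w => (U w, V w)) (isMeasurableFun.Build _ _ _ _ _ mUV).
rewrite -[LHS](@ge0_integral_distribution _ _ _ _ _ P UV psi mpsi psi0).
rewrite (@eq_measure_integral _ _ _ setT (distribution P U \x nu)%E); last first.
  move=> A mA _; apply/esym.
  exact: (@product_measure_unique _ _ _ _ _ _ _ (distribution P UV)).
rewrite (fubini_tonelli1 psi mpsi psi0) ge0_integral_distribution//.
  exact: measurable_fun_fubini_tonelli_F.
by move=> x; apply: integral_ge0 => z _.
Qed.

Section filtration.
Context {d : measure_display} {Omega : measurableType d} {R : realType}.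
Variables (P : probability Omega R) (B : R -> {RV P >-> R}).

Lemma natural_filtration_measurable (s : R) (E : set Omega) :
  natural_filtration B s E -> measurable E.
Proof.
apply: smallest_sub => [|A [u _ [C mC <-]]]; first exact: sigma_algebra_measurable.
exact: measurable_funP.
Qed.

Lemma filtration_measurableW (s t : R) (f : Omega -> R) : s <= t ->
  filtration_measurable B s f -> filtration_measurable B t f.
Proof.
move=> st mf _ C mC; have := mf measurableT C mC.
apply: sub_sigma_algebra2 => A [u us uA]; exists u => //.
move: us; rewrite /= !in_itv /= => /andP[-> us]; exact: le_trans st.
Qed.

Lemma filtration_measurable_measurable (s : R) (f : Omega -> R) :
  filtration_measurable B s f -> measurable_fun setT f.
Proof.
move=> mf _ C mC; have := mf measurableT C mC.
exact: natural_filtration_measurable.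
Qed.

Lemma filtration_measurable_BM (s u : R) : 0 <= u <= s ->
  filtration_measurable B s (B u).
Proof.
move=> us _ C mC; apply: sub_sigma_algebra; exists u; first by rewrite /= in_itv.
by exists C.
Qed.

Hypothesis hB : standard_brownian_motion B.

(** A substitute for conditioning on the past: [U] is the identity from [Omega] to [Omega] with the
    past sigma-algebra, so [psi] may depend on the past in any measurable way while the increment is
    integrated out with [w] frozen. *)
Lemma ge0_integral_BM_increment (s t : R)
    (psi : g_sigma_algebraType (past_events B s) * R -> \bar R) :
  0 <= s -> s < t -> t <= 1 ->
  measurable_fun setT psi -> (forall x, 0 <= psi x)%E ->
  (\int[P]_w psi (w, (B t w - B s w)%R) =
   \int[P]_w \int[normal_prob 0 (Num.sqrt (t - s))]_z psi (w, z))%E.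
Proof.
move=> s0 st t1 mpsi psi0.
have mid : measurable_fun [set: Omega]
    (fun w => w : g_sigma_algebraType (past_events B s)).
  move=> _ A mA; rewrite setTI; exact: natural_filtration_measurable mA.
pose U : {mfun Omega >-> g_sigma_algebraType (past_events B s)} :=
  HB.pack (fun w : Omega => w : g_sigma_algebraType (past_events B s))
    (isMeasurableFun.Build _ _ _ _ _ mid).
have mBB : measurable_fun [set: Omega]
    (fun w => (B t w - B s w : measurableTypeR R)) by exact: measurable_funB.
pose V : {mfun Omega >-> measurableTypeR R} :=
  HB.pack (fun w : Omega => (B t w - B s w : measurableTypeR R))
    (isMeasurableFun.Build _ _ _ _ _ mBB).
pose nu : probability (measurableTypeR R) R := normal_prob 0 (Num.sqrt (t - s)).
apply: (@ge0_integral_independent _ _ _ _ _ (measurableTypeR R) _ P U V nu psi) =>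
  // A C mA mC.
rewrite /nu /= -(bm_gaussian hB)//; exact: (bm_independent hB).
Qed.

(** With the past frozen, the exponential is that of [integral_normal_prob_exp] with [theta = xi w]
    and variance [t - s], so the inner integral is 1. *)
Lemma BM_exp_step (s t : R) (xi : Omega -> R) (U : Omega -> \bar R) :
  0 <= s -> s < t -> t <= 1 ->
  filtration_measurable B s xi ->
  measurable_fun [set: g_sigma_algebraType (past_events B s)] U ->
  (forall w, 0 <= U w)%E ->
  (\int[P]_w (U w * (expR (xi w * (B t w - B s w) - xi w ^+ 2 * (t - s) / 2))%:E)
    = \int[P]_w U w)%E.
Proof.
move=> s0 st t1 mxi mU U0.
pose psi (x : g_sigma_algebraType (past_events B s) * R) : \bar R :=
  (U x.1 * (expR (xi x.1 * x.2 - xi x.1 ^+ 2 * (t - s) / 2))%:E)%E.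
have mxi1 : measurable_fun setT
    (fun x : g_sigma_algebraType (past_events B s) * R => xi x.1).
  by apply: measurableT_comp => //; exact: measurable_fst.
have mpsi2 : measurable_fun setT
    (fun x : g_sigma_algebraType (past_events B s) * R =>
      (expR (xi x.1 * x.2 - xi x.1 ^+ 2 * (t - s) / 2))%:E).
  apply/measurable_EFinP; apply: measurableT_comp => //.
  apply: measurable_funB; first exact: measurable_funM.
  by apply: measurable_funM => //; apply: measurable_funM => //;
    exact: measurable_funX.
rewrite (@ge0_integral_BM_increment s t psi)//; last 2 first.
  - apply: emeasurable_funM => //.
    by apply: measurableT_comp => //; exact: measurable_fst.
  - by move=> x; rewrite mule_ge0// lee_fin expR_ge0.
apply: eq_integral => w _; rewrite /psi/=.
rewrite ge0_integralZl//; last first.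
- apply/measurable_EFinP; apply: measurableT_comp => //.
  by apply: measurable_funB => //; exact: measurable_funM.
have ts : 0 < t - s by rewrite subr_gt0.
have := @integral_normal_prob_exp R (Num.sqrt (t - s)) (xi w).
rewrite sqr_sqrtr; last exact: ltW.
by move=> ->; rewrite ?mule1// gt_eqF// sqrtr_gt0.
Qed.

End filtration.

(** * Exponential martingale bound for simple processes *)

Lemma ge0_markov {d} {T : measurableType d} {R : realType}
    (mu : {measure set T -> \bar R}) (f : T -> \bar R) (S : set T) (k : R) :
  measurable_fun setT f -> (forall x, 0 <= f x)%E -> measurable S -> 0 <= k ->
  (forall x, S x -> k%:E <= f x)%E ->
  (k%:E * mu S <= \int[mu]_x f x)%E.
Proof.
move=> mf f0 mS k0 kf; rewrite -integral_cst//.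
apply: (@le_trans _ _ (\int[mu]_(x in S) f x)%E).
  by apply: ge0_le_integral => //; exact: measurable_funTS.
exact: ge0_subset_integral.
Qed.

(** One formula for two objects: with [b] a Brownian path it is the stochastic integral of a step
    process, and with [b] the identity and squared coefficients it is the energy of that process. *)
Definition grid_sum {R : realType} (n : nat) (tau c : nat -> R) (b : R -> R) : R :=
  \sum_(i < n) c i * (b (tau i.+1) - b (tau i)).

Section exponential_bound.
Context {d : measure_display} {Omega : measurableType d} {R : realType}.
Variables (P : probability Omega R) (B : R -> {RV P >-> R}).
Hypothesis hB : standard_brownian_motion B.
Variables (N : nat) (tau : nat -> R) (c : nat -> Omega -> R).
Hypothesis tau_unit : forall i, (i <= N)%N -> 0 <= tau i <= 1.
Hypothesis tau_incr : forall i, (i < N)%N -> tau i < tau i.+1.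
Hypothesis mc : forall i, (i < N)%N -> filtration_measurable B (tau i) (c i).

Local Notation M n w := (grid_sum n tau (c^~ w) (B^~ w)).
Local Notation V n w := (grid_sum n tau (fun i => c i w ^+ 2) id).
Local Notation E lambda n w := (expR (lambda * M n w - lambda ^+ 2 * V n w / 2)).

Let mM n : (n <= N)%N -> filtration_measurable B (tau n) (fun w => M n w).
Proof.
elim: n => [|n IH] nN.
  by rewrite /grid_sum; under eq_fun do rewrite big_ord0; exact: measurable_cst.
rewrite /grid_sum; under eq_fun do rewrite big_ord_recr/=.
have [h1 h2] := andP (tau_unit (ltnW nN)).
have nn := ltW (tau_incr nN).
apply: measurable_funD.
  by apply: filtration_measurableW (IH (ltnW nN)).
apply: measurable_funM; first exact: filtration_measurableW (mc nN).
have [h3 h4] := andP (tau_unit nN).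
by apply: measurable_funB; apply: filtration_measurable_BM; rewrite ?h1 ?h3/=.
Qed.

Let mV n : (n <= N)%N -> filtration_measurable B (tau n) (fun w => V n w).
Proof.
elim: n => [|n IH] nN.
  by rewrite /grid_sum; under eq_fun do rewrite big_ord0; exact: measurable_cst.
rewrite /grid_sum; under eq_fun do rewrite big_ord_recr/=.
have nn := ltW (tau_incr nN).
apply: measurable_funD.
  by apply: filtration_measurableW (IH (ltnW nN)).
apply: measurable_funM; last exact: measurable_cst.
by apply: measurable_funX; exact: filtration_measurableW (mc nN).
Qed.

Let mE lambda n : (n <= N)%N -> filtration_measurable B (tau n) (fun w => E lambda n w).
Proof.
move=> nN; apply: measurableT_comp => //; apply: measurable_funB.
  by apply: measurable_funM => //; exact: mM.
by apply: measurable_funM => //; apply: measurable_funM => //; exact: mV.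
Qed.

(** One more cell multiplies [E] by the factor of [BM_exp_step] with [xi = lambda * c n], and the
    previous value of [E] serves as [U]. *)
Lemma exponential_martingale lambda n : (n <= N)%N ->
  (\int[P]_w (E lambda n w)%:E = 1)%E.
Proof.
elim: n => [|n IH] nN.
  rewrite (eq_integral (cst 1%E)); first
    by rewrite integral_cst// mul1e; exact: probability_setT.
  move=> w _.
  by rewrite /grid_sum !big_ord0 !(mulr0, mul0r) subr0 expR0.
have [h1 _] := andP (tau_unit (ltnW nN)); have [_ h4] := andP (tau_unit nN).
rewrite -(IH (ltnW nN)).
rewrite -[RHS](BM_exp_step hB (xi := fun w => lambda * c n w) h1 (tau_incr nN) h4)//.
- apply: eq_integral => w _; rewrite -EFinM -expRD; congr (expR _)%:E.
  by rewrite /grid_sum !big_ord_recr/=; field.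
- by apply: measurable_funM => //; exact: mc.
- by apply/measurable_EFinP; exact: (mE lambda (ltnW nN)).
Qed.

Let mMT : measurable_fun setT (fun w => M N w).
Proof. exact: filtration_measurable_measurable (mM (leqnn N)). Qed.

Let mVT : measurable_fun setT (fun w => V N w).
Proof. exact: filtration_measurable_measurable (mV (leqnn N)). Qed.

(** Chernoff's bound; the sign [s] treats both tails at once. On the event, [E] at
    [lambda = s * x / y] is at least [expR (x ^+ 2 / (2 * y))], while its mean is 1. This [lambda]
    is optimal: its modulus maximises [lambda * x - lambda ^+ 2 * y / 2]. *)
Let one_sided_tail (x y s : R) : 0 < x -> 0 < y -> s ^+ 2 = 1 ->
  (P [set w | (x <= s * M N w)%R /\ (V N w <= y)%R]
    <= (expR (- (x ^+ 2 / (2 * y))))%:E)%E.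
Proof.
move=> x0 y0 s1; set S := [set w | _].
have mS : measurable S.
  have -> : S = [set w | x <= s * M N w] `&` [set w | V N w <= y] by [].
  apply: measurableI; rewrite -[X in measurable X]setTI.
    by apply: measurable_fun_le => //; exact: measurable_funM.
  exact: measurable_fun_le.
have := @ge0_markov _ _ _ P (fun w => (E (s * x / y) N w)%:E) S (expR (x ^+ 2 / (2 * y))).
rewrite /= exponential_martingale// expRN => H.
rewrite -[X in (P X)]/S -(mul1e (_^-1)%:E) lee_pdivlMr ?expR_gt0// muleC.
apply: H => //.
- apply/measurable_EFinP.
  exact: filtration_measurable_measurable (mE _ (leqnn N)).
- move=> w [xM Vy]; rewrite lee_fin ler_expR.
  rewrite [X in X * V N w](_ : _ = (x / y) ^+ 2); last first.
    by rewrite !exprMn s1 mul1r.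
  have -> : s * x / y * M N w = x / y * (s * M N w) by field; rewrite gt_eqF.
  have xy0 : 0 <= x / y by rewrite divr_ge0// ltW.
  have h1 : x / y * x <= x / y * (s * M N w) by rewrite ler_wpM2l.
  have h2 : (x / y) ^+ 2 * V N w <= (x / y) ^+ 2 * y.
    by rewrite ler_wpM2l// exprn_ge0.
  have -> : x ^+ 2 / (2 * y) = x / y * x - (x / y) ^+ 2 * y / 2.
    by field; rewrite gt_eqF.
  by rewrite lerB// ler_pM2r.
Qed.

Lemma grid_tail (x y : R) : 0 < x -> 0 < y ->
  (P [set w | (x <= `|M N w|)%R /\ (V N w <= y)%R]
    <= (2 * expR (- (x ^+ 2 / (2 * y))))%:E)%E.
Proof.
move=> x0 y0.
have mS s : measurable [set w | x <= s * M N w /\ V N w <= y].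
  rewrite [X in measurable X](_ : _ =
    [set w | x <= s * M N w] `&` [set w | V N w <= y])//.
  apply: measurableI; rewrite -[X in measurable X]setTI.
    by apply: measurable_fun_le => //; exact: measurable_funM.
  exact: measurable_fun_le.
rewrite [X in P X](_ : _ = [set w | x <= 1 * M N w /\ V N w <= y] `|`
    [set w | x <= -1 * M N w /\ V N w <= y]); last first.
  apply/seteqP; split => w /=; rewrite mul1r mulN1r ler_normr.
    by move=> [/orP[] ? ?]; [left|right].
  by move=> [] [-> ?]; rewrite ?orbT.
apply: (le_trans (measureU2 _ _ _)) => //.
rewrite mulr_natl mulr2n EFinD.
by apply: leeD; apply: one_sided_tail => //; rewrite ?sqrrN expr1n.
Qed.

End exponential_bound.

(** * Common grids for simple processes *)

Record time_grid {R : realType} (N : nat) (tau : nat -> R) : Prop := TimeGrid {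
  grid_first : tau 0 = 0 ;
  grid_last : tau N = 1 ;
  grid_incr : forall i, (i < N)%N -> tau i < tau i.+1 ;
  grid_unit : forall i, (i <= N)%N -> 0 <= tau i <= 1
}.

(** The time [t] splits no cell. Stated cell by cell, without an index for [t], this directly
    decides which steps of a simple process cover a given cell. *)
Definition grid_refines {R : realType} (N : nat) (tau : nat -> R) (t : R) : Prop :=
  forall j, (j < N)%N -> (t <= tau j) || (tau j.+1 <= t).

(** Sort the given times together with 0 and 1, without repetition. A listed time inside a cell
    would have an index strictly between [j] and [j.+1]. *)
Lemma common_grid {R : realType} (ts : seq R) :
  (forall t, t \in ts -> 0 <= t <= 1) ->
  exists N tau, time_grid N tau /\ {in ts, forall t, grid_refines N tau t}.
Proof.
move=> ts01; pose s := sort <=%O (undup [:: 0, 1 & ts]).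
have us : sorted <%O s by rewrite Order.TotalTheory.sort_lt_sorted undup_uniq.
have mems t : (t \in s) = [|| t == 0, t == 1 | t \in ts].
  by rewrite mem_sort mem_undup !inE.
have s01 t : t \in s -> 0 <= t <= 1.
  by rewrite mems => /or3P[/eqP->|/eqP->|/ts01//]; rewrite ?lexx ?ler01.
have s_gt0 : (0 < size s)%N.
  have : 0 \in s by rewrite mems eqxx.
  by case: (s).
have nth_incr :
    {in [pred n | (n < size s)%N] &, {mono nth 0 s : i j / (i < j)%N >-> i < j}}.
  exact: Order.POrderTheory.lt_sorted_ltn_nth.
have tau01 i : (i < size s)%N -> 0 <= nth 0 s i <= 1.
  by move=> si; apply: s01; rewrite mem_nth.
exists (size s).-1, (nth 0 s); split; first split.
- have /nthP : 0 \in s by rewrite mems eqxx.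
  move=> /(_ 0)[k ks k0]; case: k ks k0 => [//|k] ks k0.
  have := nth_incr 0%N k.+1; rewrite !inE s_gt0 ks k0 => /(_ isT isT).
  by have /andP[+ _] := tau01 _ s_gt0; rewrite leNgt => /negbTE ->.
- have /nthP : 1 \in s by rewrite mems eqxx orbT.
  move=> /(_ 0)[k ks k1]; have := ks; rewrite -{1}(prednK s_gt0) ltnS.
  rewrite leq_eqVlt => /predU1P[<-//|kN].
  have := nth_incr k (size s).-1; rewrite !inE ks prednK// leqnn k1 kN => /(_ isT isT).
  have /andP[_ +] : 0 <= nth 0 s (size s).-1 <= 1 by apply: tau01; rewrite prednK.
  by rewrite leNgt => /negbTE ->.
- by move=> i iN; rewrite nth_incr// inE; rewrite -(prednK s_gt0) ltnS// ltnW.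
- by move=> i iN; apply: tau01; rewrite -(prednK s_gt0) ltnS.
- move=> t tts j jN.
  have /nthP : t \in s by rewrite mems tts !orbT.
  move=> /(_ 0)[k ks <-].
  have js : (j.+1 < size s)%N by rewrite -(prednK s_gt0) ltnS.
  rewrite ![_ <= _]leNgt !nth_incr ?inE// ?(ltnW js)// -negb_and ltnS.
  by apply/negP => /andP[jk kj]; have := leq_trans jk kj; rewrite ltnn.
Qed.

Lemma integral_grid {R : realType} (N : nat) (tau : nat -> R) (g : R -> R) :
  time_grid N tau -> measurable_fun setT g -> (forall s, 0 <= g s) ->
  (forall j s, (j < N)%N -> tau j < s <= tau j.+1 -> g s = g (tau j.+1)) ->
  (\int[lebesgue_measure]_(s in `[0%R, 1%R]) (g s)%:E =
   (grid_sum N tau (fun j => g (tau j.+1)) id)%:E)%E.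
Proof.
move=> grid mg g0 gE.
(* The cells are open on the left, like the steps of a simple process, so they miss the point 0,
   which is negligible. *)
rewrite -integral_itv_obnd_cbnd; last first.
  by apply/measurable_EFinP; exact: measurable_funTS.
rewrite -{1}(grid_first grid) -{1}(grid_last grid).
suff H n : (n <= N)%N -> tau 0 <= tau n /\
   (\int[lebesgue_measure]_(s in `]tau 0%N, tau n]) (g s)%:E =
   (grid_sum n tau (fun j => g (tau j.+1)) id)%:E)%E by have [] := H N (leqnn N).
elim: n => [|n IH] nN.
  by rewrite set_itvoc0 integral_set0 /grid_sum big_ord0.
have [t0n Hn] := IH (ltnW nN); have tn := grid_incr grid nN.
split; first exact: le_trans (ltW tn).
have -> : [set` `]tau 0%N, tau n.+1]] = `]tau 0%N, tau n] `|` `]tau n, tau n.+1].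
  by apply: itv_bndbnd_setU; rewrite bnd_simp// ltW.
rewrite ge0_integral_setU//=; last 3 first.
- by apply/measurable_EFinP; exact: measurable_funTS.
- by move=> s _; rewrite lee_fin.
- apply/disj_setPS => s [] /=; rewrite !in_itv/= => /andP[_ sn] /andP[ns _].
  by have := lt_le_trans ns sn; rewrite ltxx.
rewrite Hn (eq_integral (cst (g (tau n.+1))%:E)); last first.
  by move=> s; rewrite inE/= in_itv/= => ns; rewrite (gE n).
rewrite integral_cst//= lebesgue_measure_itv/= lte_fin tn -EFinB -EFinM -EFinD.
by rewrite /grid_sum big_ord_recr.
Qed.

Section simple_process_on_grid.
Context {d : measure_display} {Omega : measurableType d} {R : realType}.
Variables (P : probability Omega R) (B : R -> {RV P >-> R}).
Variables (h : simple_process B) (N : nat) (tau : nat -> R).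
Hypothesis grid : time_grid N tau.
Hypothesis refines : forall i, (i <= sp_size h)%N -> grid_refines N tau (sp_time h i).

Let tau_incr := grid_incr grid.

(** Since neither end of the step splits the cell, the cell is either contained in the step or
    disjoint from it. *)
Let step_indic i j s : (i < sp_size h)%N -> (j < N)%N -> tau j < s <= tau j.+1 ->
  \1_(`]sp_time h i, sp_time h i.+1]) s =
  ((sp_time h i <= tau j) && (tau j.+1 <= sp_time h i.+1))%:R :> R.
Proof.
move=> iN jN /andP[js sj]; rewrite indicE mem_setE; congr (nat_of_bool _)%:R.
rewrite in_itv/=; congr (_ && _).
- have /orP[tj|jt] := refines (ltnW iN) jN; first by rewrite tj (le_lt_trans tj).
  rewrite ltNge (le_trans sj jt)/=; apply/esym/negbTE; rewrite -ltNge.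
  exact: lt_le_trans (tau_incr jN) jt.
- have /orP[tj|jt] := refines iN jN; last by rewrite jt (le_trans sj).
  rewrite leNgt (le_lt_trans tj js)/=; apply/esym/negbTE; rewrite -ltNge.
  exact: le_lt_trans tj (tau_incr jN).
Qed.

Let last_step j : (j < N)%N -> tau j < tau j.+1 <= tau j.+1.
Proof. by move=> jN; rewrite lexx tau_incr. Qed.

Lemma sp_eval_grid (j : nat) (s : R) (w : Omega) : (j < N)%N ->
  tau j < s <= tau j.+1 -> sp_eval h s w = sp_eval h (tau j.+1) w.
Proof.
move=> jN sj; apply: eq_bigr => i _.
by rewrite (step_indic (ltn_ord i) jN sj) (step_indic (ltn_ord i) jN (last_step jN)).
Qed.

(** The value is sampled at the right end of the cell but known at its left end: a step that covers
    the cell starts no later than [tau j], and so its coefficient is measurable there. *)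
Lemma filtration_measurable_sp_eval (j : nat) : (j < N)%N ->
  filtration_measurable B (tau j) (sp_eval h (tau j.+1)).
Proof.
move=> jN; apply: measurable_sum => i.
under eq_fun do rewrite (step_indic (ltn_ord i) jN (last_step jN)).
have [tj|_] := boolP (sp_time h i <= tau j); last first.
  by under eq_fun do rewrite mulr0; exact: measurable_cst.
apply: measurable_funM; last exact: measurable_cst.
exact: filtration_measurableW (sp_coef_measurable (ltn_ord i)).
Qed.

Lemma sp_integral_grid (w : Omega) :
  sp_integral h w = grid_sum N tau (fun j => sp_eval h (tau j.+1) w) (B^~ w).
Proof.
rewrite /grid_sum; under [RHS]eq_bigr do rewrite mulr_suml.
rewrite exchange_big/=; apply: eq_bigr => i _.
under eq_bigr do rewrite -mulrA.
rewrite -mulr_sumr; congr (_ * _).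
have ti := ltn_ord i; have tt := sp_time_incr ti.
(* [clamp] projects a time onto the step. The clamped path telescopes over the grid to the increment
   over the step, and the cells outside the step contribute zero. *)
pose clamp x := Num.min (Num.max x (sp_time h i)) (sp_time h i.+1).
transitivity (\sum_(0 <= j < N)
    (B (clamp (tau j.+1)) w - B (clamp (tau j)) w)).
  rewrite (telescope_sumr (fun j => B (clamp (tau j)) w))//.
  rewrite (grid_first grid) (grid_last grid).
  have := sp_time_unit (ltnW ti); have := @sp_time_unit _ _ _ _ _ h i.+1 ti.
  rewrite !in_itv/= => /andP[h1 h2] /andP[h3 h4].
  by rewrite /clamp (max_l h4) (max_r h3) (min_r h2) (min_l (ltW tt)).
rewrite big_mkord; apply: eq_bigr => j _.
rewrite (step_indic ti (ltn_ord j) (last_step (ltn_ord j))).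
have jj := ltW (tau_incr (ltn_ord j)).
rewrite /clamp; have /orP[tj|jt] := refines (ltnW ti) (ltn_ord j).
  rewrite tj (max_l tj) (max_l (le_trans tj jj)).
  have /orP[tj'|jt'] := refines ti (ltn_ord j).
    rewrite (min_r tj') (min_r (le_trans tj' jj)) subrr leNgt.
    by rewrite (le_lt_trans tj' (tau_incr (ltn_ord j))) mul0r.
  by rewrite jt' (min_l jt') (min_l (le_trans jj jt')) mul1r.
rewrite (max_r jt) (max_r (le_trans jj jt)) subrr leNgt.
by rewrite (lt_le_trans (tau_incr (ltn_ord j)) jt) mul0r.
Qed.

End simple_process_on_grid.

(** * Tail bound for increments of Ito integrals *)

Section unit_interval_slices.
Context {d : measure_display} {Omega : measurableType d} {R : realType}.
Variable f : R * Omega -> R.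
Hypothesis mf : measurable_fun ((`[0, 1]%classic : set R) `*` [set: Omega]) f.

Lemma measurable_slice (w : Omega) :
  measurable_fun (`[0, 1]%classic : set R) (fun s => f (s, w)).
Proof.
apply: (@measurable_comp _ _ _ _ _ _ ((`[0, 1]%classic : set R) `*` setT) f _
  (fun s => (s, w))) => //.
- exact: measurableX.
- by move=> z [s s01 <-]; split.
- apply: measurable_funTS; apply: measurable_fun_pair => //; exact: measurable_cst.
Qed.

Lemma measurable_slice_integral : (forall z, 0 <= f z) ->
  measurable_fun setT (fun w =>
    \int[lebesgue_measure]_(s in `[0%R, 1%R]) (f (s, w))%:E)%E.
Proof.
move=> f0; pose D : set (R * Omega) := (`[0, 1]%classic : set R) `*` setT.
have mD : measurable D by exact: measurableX.
(* Measurability is known on the strip only; extension by zero gives a function on the whole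
   product, to which Tonelli applies. *)
pose g : R * Omega -> \bar R := (EFin \o f) \_ D.
have mg : measurable_fun setT g.
  have mf' : measurable_fun D (EFin \o f) by apply: measurableT_comp.
  exact: (measurable_restrictT (EFin \o f) mD).1 mf'.
have g0 z : (0 <= g z)%E.
  by rewrite /g patchE; case: ifPn => // _; rewrite lee_fin.
have := @measurable_fun_fubini_tonelli_G _ _ _ _ R lebesgue_measure g mg g0.
congr (measurable_fun _ _); apply/funext => w.
rewrite /fubini_G [RHS]integral_mkcond; apply: eq_integral => s _.
rewrite /g !patchE; congr (if _ then _ else _).
by apply/idP/idP; rewrite !inE => -[]//.
Qed.

End unit_interval_slices.

Section ito_tail.
Context {d : measure_display} {Omega : measurableType d} {R : realType}.
Variables (P : probability Omega R) (B : R -> {RV P >-> R}).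
Hypothesis hB : standard_brownian_motion B.

Lemma measurable_sp_eval (h : simple_process B) :
  measurable_fun setT (fun z : R * Omega => sp_eval h z.1 z.2).
Proof.
apply: measurable_sum => i; apply: measurable_funM.
  apply: measurableT_comp; last exact: measurable_snd.
  exact: filtration_measurable_measurable (sp_coef_measurable (ltn_ord i)).
apply: measurableT_comp; last exact: measurable_fst.
exact: measurable_indic.
Qed.

Lemma measurable_sp_eval_path (h : simple_process B) (w : Omega) :
  measurable_fun setT (sp_eval h ^~ w).
Proof.
apply: measurable_sum => i; apply: measurable_funM; first exact: measurable_cst.
exact: measurable_indic.
Qed.

Lemma measurable_sp_integral (h : simple_process B) :
  measurable_fun setT (sp_integral h).
Proof.
apply: measurable_sum => i; apply: measurable_funM; last exact: measurable_funB.
exact: filtration_measurable_measurable (sp_coef_measurable (ltn_ord i)).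
Qed.

(** The two processes have unrelated partitions, but on a common grid their difference is a single
    step process with coefficients [c], to which [grid_tail] applies. *)
Lemma sp_increment_tail (h1 h2 : simple_process B) (x y : R) : 0 < x -> 0 < y ->
  (P [set w | (x <= `|sp_integral h2 w - sp_integral h1 w|)%R /\
        \int[lebesgue_measure]_(s in `[0%R, 1%R])
          ((sp_eval h2 s w - sp_eval h1 s w) ^+ 2)%:E <= y%:E]
    <= (2 * expR (- (x ^+ 2 / (2 * y))))%:E)%E.
Proof.
move=> x0 y0.
pose ts := [seq sp_time h1 i | i <- iota 0 (sp_size h1).+1] ++
           [seq sp_time h2 i | i <- iota 0 (sp_size h2).+1].
have ts01 t : t \in ts -> 0 <= t <= 1.
  rewrite mem_cat => /orP[] /mapP[i]; rewrite mem_iota add0n ltnS/= => iN ->.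
    by have := sp_time_unit iN; rewrite in_itv.
  by have := sp_time_unit iN; rewrite in_itv.
have [N [tau [grid refines]]] := common_grid ts01.
have ref1 i : (i <= sp_size h1)%N -> grid_refines N tau (sp_time h1 i).
  move=> iN; apply: refines; rewrite mem_cat; apply/orP; left.
  by apply/mapP; exists i => //; rewrite mem_iota add0n ltnS.
have ref2 i : (i <= sp_size h2)%N -> grid_refines N tau (sp_time h2 i).
  move=> iN; apply: refines; rewrite mem_cat; apply/orP; right.
  by apply/mapP; exists i => //; rewrite mem_iota add0n ltnS.
pose c j w := sp_eval h2 (tau j.+1) w - sp_eval h1 (tau j.+1) w.
have mc j : (j < N)%N -> filtration_measurable B (tau j) (c j).
  by move=> jN; apply: measurable_funB;
    [exact: (filtration_measurable_sp_eval grid ref2)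
    |exact: (filtration_measurable_sp_eval grid ref1)].
have := @grid_tail _ _ _ P B hB N tau c (grid_unit grid) (grid_incr grid) mc x y x0 y0.
congr (P _ <= _)%E; apply/seteqP.
have EJ w : sp_integral h2 w - sp_integral h1 w = grid_sum N tau (c^~ w) (B^~ w).
  rewrite (sp_integral_grid grid ref1) (sp_integral_grid grid ref2).
  by rewrite /grid_sum -sumrB; apply: eq_bigr => j _; rewrite mulrBl.
have EQ w : (\int[lebesgue_measure]_(s in `[0%R, 1%R])
    ((sp_eval h2 s w - sp_eval h1 s w) ^+ 2)%:E =
    (grid_sum N tau (fun j => c j w ^+ 2) id)%:E)%E.
  apply: (@integral_grid _ N tau
    (fun s => (sp_eval h2 s w - sp_eval h1 s w) ^+ 2)) => //.
  - apply: measurable_funX; apply: measurable_funB.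
      exact: measurable_sp_eval_path.
    exact: measurable_sp_eval_path.
  - by move=> s; rewrite sqr_ge0.
  - move=> j s jN sj.
    by rewrite (sp_eval_grid grid ref1 _ jN sj) (sp_eval_grid grid ref2 _ jN sj).
by split => w /=; rewrite EJ EQ lee_fin.
Qed.

Variables (H1 H2 : R -> Omega -> R) (X1 X2 : {RV P >-> R}).
Hypothesis ito1 : is_ito_integral B H1 X1.
Hypothesis ito2 : is_ito_integral B H2 X2.

Let mH1 := let: And3 m _ _ := ito1 in m.
Let mH2 := let: And3 m _ _ := ito2 in m.

Let msp (h : simple_process B) :
  measurable_fun ((`[0, 1]%classic : set R) `*` [set: Omega])
    (fun z : R * Omega => sp_eval h z.1 z.2).
Proof. by apply: measurable_funTS; exact: measurable_sp_eval. Qed.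

Lemma measurable_increment_energy : measurable_fun setT (fun w =>
  \int[lebesgue_measure]_(s in `[0%R, 1%R]) ((H2 s w - H1 s w) ^+ 2)%:E)%E.
Proof.
apply: (@measurable_slice_integral _ _ _
  (fun z : R * Omega => (H2 z.1 z.2 - H1 z.1 z.2) ^+ 2)); last first.
  by move=> z; rewrite sqr_ge0.
by apply: measurable_funX; apply: measurable_funB.
Qed.

Let dist_energy (h : simple_process B) (H : R -> Omega -> R) w : \bar R :=
  (\int[lebesgue_measure]_(s in `[0%R, 1%R]) ((sp_eval h s w - H s w) ^+ 2)%:E)%E.

Let measurable_dist_energy (h : simple_process B) (H : R -> Omega -> R) :
  measurable_fun ((`[0, 1]%classic : set R) `*` [set: Omega])
    (fun z : R * Omega => H z.1 z.2) ->
  measurable_fun setT (dist_energy h H).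
Proof.
move=> mH; apply: (@measurable_slice_integral _ _ _
  (fun z : R * Omega => (sp_eval h z.1 z.2 - H z.1 z.2) ^+ 2)); last first.
  by move=> z; rewrite sqr_ge0.
by apply: measurable_funX; apply: measurable_funB.
Qed.

(** The difference of the simple processes is a sum of three differences, and the square of a sum of
    three terms is at most three times the sum of their squares. Each term has energy at most [y],
    whence [3 * 3 * y]. *)
Let energy_triangle (h1 h2 : simple_process B) (y : R) w :
  (\int[lebesgue_measure]_(s in `[0%R, 1%R]) ((H2 s w - H1 s w) ^+ 2)%:E <= y%:E ->
   dist_energy h1 H1 w <= y%:E -> dist_energy h2 H2 w <= y%:E ->
   \int[lebesgue_measure]_(s in `[0%R, 1%R])
     ((sp_eval h2 s w - sp_eval h1 s w) ^+ 2)%:E <= (9 * y)%:E)%E.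
Proof.
move=> e1 e2 e3.
have ms (h : simple_process B) : measurable_fun (`[0, 1]%classic : set R) (sp_eval h ^~ w).
  by apply: measurable_funTS; exact: measurable_sp_eval_path.
have m1 := measurable_slice mH1 w; have m2 := measurable_slice mH2 w.
pose S : set R := `[0, 1]%classic.
have mS : measurable S by exact: measurable_itv.
pose f0 s := ((H2 s w - H1 s w) ^+ 2)%:E.
pose f1 s := ((sp_eval h1 s w - H1 s w) ^+ 2)%:E.
pose f2 s := ((sp_eval h2 s w - H2 s w) ^+ 2)%:E.
have mf0 : measurable_fun S f0.
  by apply/measurable_EFinP; apply: measurable_funX; exact: measurable_funB.
have mf1 : measurable_fun S f1.
  by apply/measurable_EFinP; apply: measurable_funX; exact: measurable_funB.
have mf2 : measurable_fun S f2.
  by apply/measurable_EFinP; apply: measurable_funX; exact: measurable_funB.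
have p0 s : (0 <= f0 s)%E by rewrite lee_fin sqr_ge0.
have p1 s : (0 <= f1 s)%E by rewrite lee_fin sqr_ge0.
have p2 s : (0 <= f2 s)%E by rewrite lee_fin sqr_ge0.
apply: (@le_trans _ _
  (\int[lebesgue_measure]_(s in S) (3%:E * (f0 s + (f1 s + f2 s))))%E).
  apply: ge0_le_integral => //.
  - by move=> s _; rewrite lee_fin sqr_ge0.
  - apply/measurable_EFinP; apply: measurable_funX.
    exact: (measurable_funB (ms h2) (ms h1)).
  - apply: emeasurable_funM => //; apply: emeasurable_funD => //.
    exact: emeasurable_funD.
  - move=> s _; rewrite -!EFinD -EFinM lee_fin.
    set a := sp_eval h2 s w; set b := sp_eval h1 s w.
    set p := H1 s w; set q := H2 s w; rewrite -subr_ge0.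
    have -> : 3 * ((q - p) ^+ 2 + ((b - p) ^+ 2 + (a - q) ^+ 2)) - (a - b) ^+ 2 =
      (q - p - (a - q)) ^+ 2 + (q - p + (b - p)) ^+ 2 + (a - q + (b - p)) ^+ 2.
      by ring.
    by rewrite !addr_ge0// sqr_ge0.
rewrite ge0_integralZl//; last 2 first.
- by apply: emeasurable_funD => //; exact: emeasurable_funD.
- by move=> s _; rewrite !adde_ge0.
rewrite ge0_integralD//; last 2 first.
- by move=> s _; rewrite adde_ge0.
- exact: emeasurable_funD.
rewrite ge0_integralD// (_ : 9 * y = 3 * (y + (y + y)))%R; last by ring.
rewrite EFinM !EFinD; apply: lee_wpmul2l; first by rewrite lee_fin.
by apply: leeD => //; exact: leeD.
Qed.

(* [72 = 2 * 9 * 4]: approximating costs a factor 9 on the energy and a factor 2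
   on the increment. *)
Lemma ito_increment_tail (x y : R) : 0 < x -> 0 < y ->
  (P [set w | (x <= `|X2 w - X1 w|)%R /\
        \int[lebesgue_measure]_(s in `[0%R, 1%R]) ((H2 s w - H1 s w) ^+ 2)%:E
          <= y%:E]
    <= (2 * expR (- (x ^+ 2 / (72 * y))))%:E)%E.
Proof.
move=> x0 y0; set S := [set w | _].
have [_ _ [h1 [hD1 hI1]]] := ito1; have [_ _ [h2 [hD2 hI2]]] := ito2.
set D1 := (X in X @ _ --> _) in hD1; set D2 := (X in X @ _ --> _) in hD2.
set I1 := (X in X @ _ --> _) in hI1; set I2 := (X in X @ _ --> _) in hI2.
(* These are the Markov factors: [a] for an error of at least [x / 4] on an integral, [b] for an
   error of energy at least [y]. The bound [u n] holds for every [n] and tends to [K]. *)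
pose a := (16 / x ^+ 2)%:E; pose b := (y^-1)%:E.
pose K := (2 * expR (- (x ^+ 2 / (72 * y))))%:E.
pose u n := (K + ((a * I1 n + a * I2 n) + (b * D1 n + b * D2 n)))%E.
have cvg0Z (r : R) (v : (\bar R)^nat) : v @ \oo --> 0%E ->
    (fun n => r%:E * v n)%E @ \oo --> 0%E.
  by move=> v0; rewrite -[X in _ --> X](mule0 r%:E); apply: cvgeZl.
have cvg0D (v1 v2 : (\bar R)^nat) : v1 @ \oo --> 0%E -> v2 @ \oo --> 0%E ->
    (fun n => v1 n + v2 n)%E @ \oo --> 0%E.
  by move=> v10 v20; rewrite -[X in _ --> X]adde0; apply: cvgeD.
have uK : u @ \oo --> K.
  rewrite -[X in _ --> X]adde0; apply: cvgeD => //; first exact: cvg_cst.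
  apply: (cvg0D _ _ (cvg0D _ _ _ _) (cvg0D _ _ _ _)).
  - exact: (cvg0Z _ _ hI1).
  - exact: (cvg0Z _ _ hI2).
  - exact: (cvg0Z _ _ hD1).
  - exact: (cvg0Z _ _ hD2).
rewrite -/K -(cvg_lim _ uK)//; apply: lime_ge; first by apply/cvg_ex; exists K.
apply: nearW => n.
pose G := [set w | (x / 2 <= `|sp_integral (h2 n) w - sp_integral (h1 n) w|)%R /\
   (\int[lebesgue_measure]_(s in `[0%R, 1%R])
          ((sp_eval (h2 n) s w - sp_eval (h1 n) s w) ^+ 2)%:E <= (9 * y)%:E)%E].
pose E (h : simple_process B) (X : {RV P >-> R}) :=
  [set w | (x / 4) ^+ 2 <= (sp_integral h w - X w) ^+ 2].
pose F (h : simple_process B) H := [set w | (y%:E <= dist_energy h H w)%E].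
have mXX (h : simple_process B) (X : {RV P >-> R}) :
    measurable_fun setT (fun w => (sp_integral h w - X w) ^+ 2).
  by apply: measurable_funX; apply: measurable_funB => //; exact: measurable_sp_integral.
have mE h X : measurable (E h X).
  by rewrite -[X in measurable X]setTI; exact: measurable_fun_le.
have mF h H : measurable_fun ((`[0, 1]%classic : set R) `*` [set: Omega])
    (fun z : R * Omega => H z.1 z.2) -> measurable (F h H).
  move=> mH; rewrite -[X in measurable X]setTI; apply: emeasurable_fun_c_infty => //.
  exact: measurable_dist_energy.
have PE h X : (P (E h X) <= a * 'E_P[fun w => ((sp_integral h w - X w) ^+ 2)%R])%E.
  have := @ge0_markov _ _ _ P (fun w => ((sp_integral h w - X w) ^+ 2)%:E) (E h X)
    ((x / 4) ^+ 2).
  rewrite unlock => /(_ _ _ (mE h X)) H.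
  rewrite muleC /a (_ : 16 / x ^+ 2 = ((x / 4) ^+ 2)^-1)%R; last first.
    by field; rewrite gt_eqF.
  rewrite lee_pdivlMr ?exprn_gt0 ?divr_gt0// muleC; apply: H => //.
  - exact/measurable_EFinP.
  - by move=> w; rewrite lee_fin sqr_ge0.
  - by rewrite sqr_ge0.
have PF h H : measurable_fun ((`[0, 1]%classic : set R) `*` [set: Omega])
    (fun z : R * Omega => H z.1 z.2) ->
    (P (F h H) <= b * \int[P]_w dist_energy h H w)%E.
  move=> mH; rewrite muleC lee_pdivlMr// muleC.
  apply: ge0_markov => //.
  - exact: measurable_dist_energy.
  - by move=> w; apply: integral_ge0 => s _; rewrite lee_fin sqr_ge0.
  - exact: mF.
  - exact: ltW.
have PG : (P G <= K)%E.
  have := @sp_increment_tail (h1 n) (h2 n) (x / 2) (9 * y).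
  rewrite /K (_ : x ^+ 2 / (72 * y) = (x / 2) ^+ 2 / (2 * (9 * y)))%R; last first.
    by field; rewrite gt_eqF.
  by apply; rewrite ?divr_gt0 ?mulr_gt0.
have mG : measurable G.
  rewrite [G](_ : _ =
   [set w | (x / 2 <= `|sp_integral (h2 n) w - sp_integral (h1 n) w|)%R]
   `&` [set w | (\int[lebesgue_measure]_(s in `[0%R, 1%R])
          ((sp_eval (h2 n) s w - sp_eval (h1 n) s w) ^+ 2)%:E <= (9 * y)%:E)%E])//.
  apply: measurableI; rewrite -[X in measurable X]setTI.
    apply: measurable_fun_le => //; apply: measurableT_comp => //.
    by apply: measurable_funB; exact: measurable_sp_integral.
  by apply: emeasurable_fun_infty_c => //; exact: measurable_dist_energy.
have mS : measurable S.
  rewrite [S](_ : _ = [set w | (x <= `|X2 w - X1 w|)%R] `&`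
    [set w | (\int[lebesgue_measure]_(s in `[0%R, 1%R]) ((H2 s w - H1 s w) ^+ 2)%:E
          <= y%:E)%E])//.
  apply: measurableI; rewrite -[X in measurable X]setTI.
    by apply: measurable_fun_le => //; apply: measurableT_comp => //; exact: measurable_funB.
  by apply: emeasurable_fun_infty_c => //; exact: measurable_increment_energy.
(* Off the four error events each integral is within [x / 4] of its limit, so at least [x / 2] of
   the increment remains, and [energy_triangle] bounds the energy by [9 * y]. *)
have sub : S `<=` G `|` ((E (h1 n) X1 `|` E (h2 n) X2) `|` (F (h1 n) H1 `|` F (h2 n) H2)).
  move=> w [xX eH].
  have x4 : 0 <= x / 4 by rewrite divr_ge0// ltW.
  have [f1|/ltW f1] := leP y%:E (dist_energy (h1 n) H1 w); first by right; right; left.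
  have [f2|/ltW f2] := leP y%:E (dist_energy (h2 n) H2 w); first by right; right; right.
  have [e1|e1] := leP ((x / 4) ^+ 2) ((sp_integral (h1 n) w - X1 w) ^+ 2).
    by right; left; left.
  have [e2|e2] := leP ((x / 4) ^+ 2) ((sp_integral (h2 n) w - X2 w) ^+ 2).
    by right; left; right.
  left; split; last exact: energy_triangle.
  move: e1 e2; rewrite -![(_ - _) ^+ 2]real_normK ?num_real//.
  rewrite !ltr_pXn2r ?nnegrE// => e1 e2.
  have := ler_normD (X2 w - sp_integral (h2 n) w)
    (sp_integral (h2 n) w - sp_integral (h1 n) w + (sp_integral (h1 n) w - X1 w)).
  have := ler_normD (sp_integral (h2 n) w - sp_integral (h1 n) w)
    (sp_integral (h1 n) w - X1 w).
  rewrite distrC in e2.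
  have -> : X2 w - sp_integral (h2 n) w +
    (sp_integral (h2 n) w - sp_integral (h1 n) w + (sp_integral (h1 n) w - X1 w)) =
    X2 w - X1 w by ring.
  lra.
have mE12 := measurableU _ _ (mE (h1 n) X1) (mE (h2 n) X2).
have mF12 := measurableU _ _ (mF (h1 n) H1 mH1) (mF (h2 n) H2 mH2).
apply: (@le_trans _ _ (P (G `|` ((E (h1 n) X1 `|` E (h2 n) X2) `|`
    (F (h1 n) H1 `|` F (h2 n) H2))))).
  by apply: le_measure; rewrite ?inE//; apply: measurableU => //; exact: measurableU.
apply: (le_trans (measureU2 _ mG (measurableU _ _ mE12 mF12))); apply: leeD => //.
apply: (le_trans (measureU2 _ mE12 mF12)); apply: leeD.
  apply: (le_trans (measureU2 _ (mE _ _) (mE _ _))).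
  by apply: leeD; exact: PE.
apply: (le_trans (measureU2 _ (mF _ _ mH1) (mF _ _ mH2))).
by apply: leeD; exact: PF.
Qed.

End ito_tail.

(** * Energy of the kernel increments *)

Lemma powR_splitB {R : realType} (x p q : R) : 0 < x -> x `^ p = x `^ q * x `^ (p - q).
Proof.
by move=> x0; rewrite -powRD ?(gt_eqF x0) ?implybT// (addrC q) subrK.
Qed.

Lemma powR_antimono {R : realType} (x y p : R) : 0 < x -> x <= y -> p <= 0 ->
  y `^ p <= x `^ p.
Proof.
move=> x0 xy p0; have y0 := lt_le_trans x0 xy.
rewrite -(opprK p) !(powRN _ (- p)) lef_pV2 ?posrE ?powR_gt0//.
by apply: ge0_ler_powR; rewrite ?oppr_ge0// nnegrE ltW.
Qed.

(** After factoring out [u] to the power [theta], what remains is that [1 + h / u], a base of at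
    least 1, does not grow when raised to a power at most 1. *)
Lemma powR_increment_le_derivative {R : realType} (u h theta : R) :
  0 < u -> 0 <= h -> theta <= 1 ->
  (u + h) `^ theta - u `^ theta <= h * u `^ (theta - 1).
Proof.
move=> u0 h0 th1.
have hu : 0 <= h / u by rewrite divr_ge0// ltW.
have -> : u + h = u * (1 + h / u) by field; rewrite gt_eqF.
rewrite powRM ?(ltW u0) ?addr_ge0//.
have : (1 + h / u) `^ theta <= 1 + h / u by apply: ler1_powR => //; rewrite lerDl.
move=> /(ler_wpM2l (powR_ge0 u theta)).
have -> : u `^ (theta - 1) = u `^ theta / u.
  by rewrite powRB ?(gt_eqF u0) ?implybT// powRr1// ltW.
move=> H; rewrite lerBlDl; move: H; congr (_ <= _).
by field; rewrite gt_eqF.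
Qed.

(* Interpolates between the bound [h ^ theta], which is good for [u <= h], and
   the derivative bound [h * u ^ (theta - 1)], which is good for [h <= u]. *)
Lemma powR_increment_interpolate {R : realType} (u h theta b : R) :
  0 < u -> 0 < h -> 0 <= theta -> theta <= b -> b <= 1 ->
  (u + h) `^ theta - u `^ theta <= 2 * (h `^ b * u `^ (theta - b)).
Proof.
move=> u0 h0 th0 thb b1; have th1 := le_trans thb b1.
have [uh|/ltW hu] := leP u h.
  apply: (@le_trans _ _ ((2 * h) `^ theta)).
    apply: (@le_trans _ _ ((u + h) `^ theta)).
      by rewrite gerBl powR_ge0.
    by apply: ge0_ler_powR => //; rewrite ?nnegrE; lra.
  rewrite powRM// ?(ltW h0)//; apply: ler_pM; rewrite ?powR_ge0//.
    by apply: ler1_powR => //; lra.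
  rewrite (powR_splitB theta b h0) ler_wpM2l ?powR_ge0//.
  by apply: powR_antimono => //; lra.
apply: (le_trans (powR_increment_le_derivative u0 (ltW h0) th1)).
apply: (@le_trans _ _ (h `^ b * u `^ (theta - b))); last first.
  have := mulr_ge0 (powR_ge0 h b) (powR_ge0 u (theta - b)); lra.
rewrite -{1}(powRr1 (ltW h0)) (powR_splitB 1 b h0) -mulrA ler_wpM2l ?powR_ge0//.
have -> : u `^ (theta - b) = u `^ (1 - b) * u `^ (theta - 1).
  rewrite -powRD ?(gt_eqF u0) ?implybT//; congr (_ `^ _); ring.
rewrite ler_wpM2r ?powR_ge0//; apply: ge0_ler_powR; rewrite ?nnegrE; lra.
Qed.

Lemma sqr_powR {R : realType} (x p : R) : 0 < x -> (x `^ p) ^+ 2 = x `^ (2 * p).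
Proof. by move=> x0; rewrite mulrC powRrM powR_mulrn ?powR_ge0. Qed.

Lemma powR_le_exponent {R : realType} (u p q : R) : 0 < u -> u <= 1 -> p <= q ->
  u `^ q <= u `^ p.
Proof. by move=> u0 u1 pq; apply: ger_powR => //; rewrite u0 u1. Qed.

Lemma kernel_increment_sqr {R : realType} (a b delta al t1 t2 s : R) :
  2^-1 <= b -> b < a -> a <= 1 -> 0 < delta -> 2^-1 <= al -> al <= 1 ->
  0 <= s -> t1 < t2 -> t2 <= 1 -> (t1 - delta <= s -> s < t2 -> a <= al) ->
  (pos_powR (t2 - s) (al - 2^-1) - pos_powR (t1 - s) (al - 2^-1)) ^+ 2 <=
  (t2 - t1) `^ (2 * b) *
    (delta ^- 2 + (4 * pos_powR (t1 - s) (2 * (a - b) - 1) +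
                   pos_powR (t2 - s) (2 * (a - b) - 1))).
Proof.
move=> b12 ba a1 d0 al12 al1 s0 t12 t21 aal.
have h0 : 0 < t2 - t1 by rewrite subr_gt0.
have w0 x p : 0 <= pos_powR x p :> R by rewrite /pos_powR; case: ifP; rewrite ?powR_ge0.
have d2 : 0 <= delta ^- 2 by rewrite invr_ge0 exprn_ge0// ltW.
have hb0 := powR_ge0 (t2 - t1) (2 * b).
rewrite /pos_powR; case: ifPn => [t2s|]; last rewrite -ltNge => t2s.
  have -> : t1 - s <= 0 by lra.
  by rewrite subrr expr0n/= mulr_ge0// mulr0 !addr0.
case: ifPn => [t1s|]; last rewrite -ltNge => t1s.
  rewrite subr0 mulr0 add0r mulrDr; apply: ler_wpDl; first by rewrite mulr_ge0.
  have {}aal : a <= al by apply: aal; lra.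
  rewrite (powR_splitB _ b t2s) exprMn !sqr_powR//; apply: ler_pM; rewrite ?powR_ge0//.
    by apply: ge0_ler_powR; rewrite ?nnegrE; lra.
  by apply: powR_le_exponent; lra.
set u := t1 - s in t1s *; set h := t2 - t1 in h0 hb0 *.
have hE : t2 = t1 + h by rewrite /h; ring.
have uE : s = t1 - u by rewrite /u; ring.
clearbody u h; have -> : t2 - s = u + h by rewrite hE uE; ring.
have f0 : 0 <= (u + h) `^ (al - 2^-1) - u `^ (al - 2^-1).
  by rewrite subr_ge0; apply: ge0_ler_powR; rewrite ?nnegrE; lra.
have [far|near] := ltP s (t1 - delta).
  apply: (@le_trans _ _ (h `^ (2 * b) * delta ^- 2)); last first.
    rewrite ler_wpM2l// lerDl addr_ge0// ?mulr_ge0 ?powR_ge0//.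
  have ud : delta <= u by lra.
  have hd : (u + h) `^ (al - 2^-1) - u `^ (al - 2^-1) <= h `^ b * delta^-1.
    apply: (le_trans (powR_increment_le_derivative t1s (ltW h0) _)); first lra.
    apply: ler_pM; rewrite ?powR_ge0// ?(ltW h0)//.
      by rewrite -{1}(powRr1 (ltW h0)); apply: powR_le_exponent; lra.
    apply: (@le_trans _ _ (u `^ (-1))).
      by apply: powR_le_exponent; lra.
    rewrite powR_inv1 ?(ltW t1s)// lef_pV2// posrE//.
  have := lerXn2r 2 _ _ hd; rewrite !nnegrE f0 mulr_ge0 ?powR_ge0 ?invr_ge0 ?(ltW d0)//.
  by rewrite exprMn sqr_powR// exprVn; apply.
apply: (@le_trans _ _ (h `^ (2 * b) * (4 * u `^ (2 * (a - b) - 1)))); last first.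
  by rewrite ler_wpM2l// addrCA lerDl addr_ge0// powR_ge0.
have {}aal : a <= al by apply: aal; lra.
have hd : (u + h) `^ (al - 2^-1) - u `^ (al - 2^-1) <=
    2 * (h `^ b * u `^ (a - 2^-1 - b)).
  (* The interpolation requires [al - 2^-1 <= b], which holds because [al <= 1] and [2^-1 <= b]. *)
  apply: (le_trans (@powR_increment_interpolate _ u h (al - 2^-1) b _ _ _ _ _)); try lra.
  rewrite !ler_wpM2l ?powR_ge0//.
  by apply: powR_le_exponent; lra.
have := lerXn2r 2 _ _ hd; rewrite !nnegrE f0 !mulr_ge0 ?powR_ge0//.
move=> /(_ isT isT) /le_trans; apply.
rewrite !exprMn !sqr_powR// (_ : 2 * (a - 2^-1 - b) = 2 * (a - b) - 1); last by field.
by rewrite mulrCA (_ : 2 ^+ 2 = 4)//; ring.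
Qed.

Lemma powR_half_lt1 {R : realType} (p : R) : 0 < p -> 2^-1 `^ p < 1 :> R.
Proof.
move=> p0; apply: (@lt_le_trans _ _ (1 `^ p)); last by rewrite powR1.
by apply: gt0_ltr_powR; rewrite ?nnegrE; lra.
Qed.

(** * Integrability of the singularity and uniform energy bound *)

Lemma measurable_pos_powR {R : realType} (p : R) :
  measurable_fun setT (fun x : R => pos_powR x p).
Proof.
rewrite (_ : (fun x => _) = (fun x : R => x `^ p * \1_(`]0, +oo[) x)); last first.
  apply/funext => x; rewrite /pos_powR indicE mem_setE in_itv/= andbT ltNge.
  by case: ifP; rewrite ?mulr0 ?mulr1.
apply: measurable_funM; first exact: measurable_powR.
exact: measurable_indic.
Qed.

Lemma measurable_pos_powR_sub {R : realType} (t p : R) :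
  measurable_fun setT (fun s : R => pos_powR (t - s) p).
Proof.
have mts : measurable_fun setT (fun s : R => t - s) by exact: measurable_funB.
exact: measurableT_comp (measurable_pos_powR p) mts.
Qed.

(* Layer-cake: if [(1/2) ^ (j + 1) < u <= (1/2) ^ j] then
   [u ^ p <= (1/2) ^ (p * (j + 1))], and the layers have geometric mass. *)
Lemma integral_pos_powR_bounded {R : realType} (p : R) : -1 < p -> p <= 0 ->
  exists2 C : R, 0 <= C & forall t, 0 <= t <= 1 ->
    (\int[lebesgue_measure]_(s in `[0%R, 1%R]) (pos_powR (t - s) p)%:E <= C%:E)%E.
Proof.
move=> p1 p0; pose q : R := 2^-1 `^ p.
have q0 : 0 < q by rewrite powR_gt0.
have q2 : q / 2 < 1.
  rewrite /q -{2}(@powRr1 _ 2^-1)// -powRD; last by apply/implyP => _; rewrite invr_eq0.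
  apply: powR_half_lt1; lra.
have q20 : 0 < q / 2 by rewrite divr_gt0.
(* Layer [j] has height [q ^+ j.+1] and length [2^-1 ^+ j], hence mass [q * (q / 2) ^+ j]; the ratio
   is below 1 because [-1 < p]. *)
exists (q * (1 - q / 2)^-1); first by rewrite mulr_ge0 ?invr_ge0; lra.
move=> t t01.
(* The layers are enlarged to overlapping intervals ending at [t]: an upper bound is enough, and
   their lengths are immediate. *)
pose f j s : \bar R := ((q ^+ j.+1) * \1_(`[t - 2^-1 ^+ j, t]) s)%:E.
have f0 j s : (0 <= f j s)%E by rewrite lee_fin mulr_ge0// exprn_ge0// ltW.
have mf j : measurable_fun setT (f j).
  by apply/measurable_EFinP; apply: measurable_funM => //; exact: measurable_indic.
have mSf : measurable_fun setT (fun s => \sum_(j <oo) f j s)%E.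
  exact: ge0_emeasurable_sum.
have mpos : measurable_fun (`[0, 1]%classic : set R) (fun s => (pos_powR (t - s) p)%:E).
  apply/measurable_EFinP; apply: measurable_funTS; exact: measurable_pos_powR_sub.
apply: (@le_trans _ _ (\int[lebesgue_measure]_(s in `[0%R, 1%R]) \sum_(j <oo) f j s)%E).
  apply: ge0_le_integral => //.
  - by move=> s _; rewrite lee_fin /pos_powR; case: ifP; rewrite ?powR_ge0.
  - exact: measurable_funTS.
  - move=> s; rewrite /= in_itv/= => /andP[s0 s1].
    rewrite /pos_powR; case: ifPn => [_|]; first exact: nneseries_ge0.
    rewrite -ltNge => u0.
    have exj : exists j, 2^-1 ^+ j.+1 < t - s.
      have half1 : `|2^-1 : R| < 1 by rewrite ger0_norm; lra.
      have /cvgrPdist_lt/(_ _ u0)[n _ /(_ n (leqnn n))] := cvg_expr half1.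
      rewrite sub0r normrN ger0_norm ?exprn_ge0// => un; exists n.
      apply: le_lt_trans un; rewrite exprS.
      have : 0 <= (2^-1 : R) ^+ n by rewrite exprn_ge0.
      lra.
    pose j := ex_minn exj.
    apply: (@le_trans _ _ (f j s)); last first.
      have := @nneseries_lim_ge R (f^~ s) xpredT 0%N j.+1 (fun i _ _ => f0 i s).
      apply: le_trans; rewrite big_nat_recr//= leeDr//.
      by apply: sume_ge0.
    rewrite lee_fin /j; case: ex_minnP => {}j uj jmin.
    rewrite indicE mem_setE in_itv/= (_ : _ && _ = true) ?mulr1; last first.
      apply/andP; split; last by lra.
      (* Minimality of [j] gives [t - s <= 2^-1 ^+ j]; for [j = 0] this comes from [t <= 1] and
         [0 <= s]. *)
      case: j uj jmin => [|j] uj jmin; first by rewrite expr0; lra.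
      rewrite lerBlDr -lerBlDl leNgt; apply/negP => /jmin; by rewrite ltnn.
    apply: (@le_trans _ _ ((2^-1 ^+ j.+1) `^ p)).
      apply: powR_antimono => //; exact: ltW.
    by rewrite -(@powR_mulrn _ 2^-1)// powRAC powR_mulrn ?powR_ge0.
apply: (@le_trans _ _ (\int[lebesgue_measure]_s \sum_(j <oo) f j s)%E).
  by apply: ge0_subset_integral => // s _; exact: nneseries_ge0.
rewrite integral_nneseries//.
have If j : (\int[lebesgue_measure]_s f j s = (geometric q (q / 2) j)%:E)%E.
  rewrite /f; under eq_integral do rewrite EFinM.
  rewrite ge0_integralZl//=; last 2 first.
  - by apply/measurable_EFinP; exact: measurable_indic.
  - by rewrite lee_fin exprn_ge0// ltW.
  rewrite integral_indic//= setIT lebesgue_measure_itv/= lte_fin.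
  rewrite ifT; last by rewrite ltrBlDr ltrDl exprn_gt0.
  by rewrite -EFinD -EFinM; congr EFin; rewrite /geometric/= exprS exprMn; ring.
under eq_eseriesr do rewrite If.
rewrite (_ : \sum_(_ <= _ <oo) _ = (q * (1 - q / 2)^-1)%:E)%E//.
apply/cvg_lim => //.
rewrite (_ : (fun n => _) = EFin \o series (geometric q (q / 2))); last first.
  by apply/funext => n; rewrite /series/= sumEFin.
apply: cvg_EFin; first by apply: nearW.
by apply: cvg_geometric_series; rewrite ger0_norm// ltW.
Qed.

(** Integrating [kernel_increment_sqr] gives a constant chosen before the path [al] and the times,
    which is what allows the same [C] for all dyadic increments of a path. The hypothesis [b < a]
    puts the exponent [p] above -1. *)
Lemma kernel_increment_energy {R : realType} (a b delta : R) :
  2^-1 <= b -> b < a -> a <= 1 -> 0 < delta ->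
  exists2 C : R, 0 < C & forall (al : R -> R) (t1 t2 : R),
    measurable_fun (`[0, 1]%classic : set R)
      (fun s => pos_powR (t2 - s) (al s - 2^-1) - pos_powR (t1 - s) (al s - 2^-1)) ->
    (forall s, 0 <= s <= 1 -> 2^-1 <= al s <= 1) ->
    0 <= t1 -> t1 < t2 -> t2 <= 1 ->
    (forall s, 0 <= s <= 1 -> t1 - delta <= s -> s < t2 -> a <= al s) ->
    (\int[lebesgue_measure]_(s in `[0%R, 1%R])
       ((pos_powR (t2 - s) (al s - 2^-1) - pos_powR (t1 - s) (al s - 2^-1)) ^+ 2)%:E
     <= (C * (t2 - t1) `^ (2 * b))%:E)%E.
Proof.
move=> b12 ba a1 d0; pose p := 2 * (a - b) - 1.
have p1 : -1 < p by rewrite /p; lra.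
have p0 : p <= 0 by rewrite /p; lra.
have [C C0 HC] := integral_pos_powR_bounded p1 p0.
have d2 : 0 < delta ^- 2 by rewrite invr_gt0 exprn_gt0.
exists (delta ^- 2 + (4 * C + C)); first by lra.
move=> al t1 t2 mf al01 t10 t12 t21 aal.
pose S : set R := `[0, 1]%classic; have mS : measurable S by exact: measurable_itv.
have mw t : measurable_fun S (fun s => (pos_powR (t - s) p)%:E).
  by apply/measurable_EFinP; apply: measurable_funTS; exact: measurable_pos_powR_sub.
have w0 t s : (0 <= (pos_powR (t - s) p)%:E)%E.
  by rewrite lee_fin /pos_powR; case: ifP => //; rewrite powR_ge0.
have mf2 : measurable_fun S (fun s =>
    ((pos_powR (t2 - s) (al s - 2^-1) - pos_powR (t1 - s) (al s - 2^-1)) ^+ 2)%:E).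
  by apply/measurable_EFinP; exact: measurable_funX.
have mw4 : measurable_fun S (fun s => 4%:E * (pos_powR (t1 - s) p)%:E)%E.
  exact: emeasurable_funM.
have mw5 : measurable_fun S (fun s =>
    4%:E * (pos_powR (t1 - s) p)%:E + (pos_powR (t2 - s) p)%:E)%E.
  exact: emeasurable_funD.
have mg : measurable_fun S (fun s => (delta ^- 2)%:E +
    (4%:E * (pos_powR (t1 - s) p)%:E + (pos_powR (t2 - s) p)%:E))%E.
  exact: emeasurable_funD.
pose H := ((t2 - t1) `^ (2 * b))%:E.
have H0 : (0 <= H)%E by rewrite lee_fin powR_ge0.
apply: (@le_trans _ _ (\int[lebesgue_measure]_(s in S) (H * ((delta ^- 2)%:E +
    (4%:E * (pos_powR (t1 - s) p)%:E + (pos_powR (t2 - s) p)%:E))))%E).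
  apply: ge0_le_integral => //.
  - by move=> s _; rewrite lee_fin sqr_ge0.
  - exact: emeasurable_funM.
  - move=> s; rewrite /= in_itv/= => s01.
    have /andP[al1 al2] := al01 s s01; have /andP[s0 s1] := s01.
    rewrite /H -!(EFinM, EFinD) lee_fin.
    by apply: kernel_increment_sqr => //; exact: aal.
rewrite ge0_integralZl//; last first.
  by move=> s _; rewrite !adde_ge0// ?mule_ge0// lee_fin ltW.
rewrite ge0_integralD//; last 2 first.
- by move=> s _; rewrite lee_fin ltW.
- by move=> s _; rewrite adde_ge0// mule_ge0.
rewrite ge0_integralD//; do ?[exact: mw|by move=> s _; rewrite mule_ge0].
have Ed : (\int[lebesgue_measure]_(s in S) (cst (delta ^- 2)%:E) s = (delta ^- 2)%:E)%E.
  by rewrite integral_cst//= /S lebesgue_measure_itv/= lte_fin ltr01 oppr0 adde0 mule1.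
rewrite ge0_integralZl//; do ?[exact: mw].
rewrite [X in (_ <= X)%E]EFinM muleC lee_wpmul2r//.
rewrite [leRHS]EFinD; apply: leeD; first by rewrite -[leRHS]Ed; exact: lexx.
rewrite [leRHS]EFinD EFinM; apply: leeD.
  apply: lee_wpmul2l => //; apply: HC; lra.
apply: HC; lra.
Qed.

(** * Dyadic chaining *)

Lemma within_continuous_dist {R : realType} (S : set R) (f : R -> R) (x e : R) :
  {within S, continuous f} -> S x -> 0 < e ->
  exists2 r, 0 < r & forall y, S y -> `|x - y| < r -> `|f x - f y| < e.
Proof.
move=> /subspace_continuousP fc Sx e0.
have /cvgrPdist_lt/(_ e e0)[r /= r0 Hr] := fc x Sx.
by exists r => // y Sy xy; exact: Hr.
Qed.

Definition dyadic {R : realType} (n k : nat) : R := k%:R / 2 ^+ n.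

Section dyadic_chaining.
Context {R : realType}.

Let pow2_gt0 n : 0 < (2 : R) ^+ n. Proof. by rewrite exprn_gt0. Qed.

Lemma dyadicS (n k : nat) : dyadic n k = dyadic n.+1 k.*2 :> R.
Proof.
rewrite /dyadic exprS -muln2 natrM.
by have := pow2_gt0 n => H; field; rewrite gt_eqF.
Qed.

Lemma ler_dyadic (n j k : nat) : (dyadic n j <= dyadic n k :> R) = (j <= k)%N.
Proof. by rewrite /dyadic ler_pM2r ?invr_gt0// ler_nat. Qed.

Lemma dyadic_trunc_le (n : nat) (t : R) : 0 <= t ->
  dyadic n (Num.truncn (t * 2 ^+ n)) <= t.
Proof.
move=> t0; rewrite ler_pdivrMr// truncn_le mulr_ge0//; exact: ltW.
Qed.

Lemma dyadic_trunc_gt (n : nat) (t : R) : t < dyadic n (Num.truncn (t * 2 ^+ n)).+1.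
Proof. by rewrite ltr_pdivlMr// truncnS_gt. Qed.

(** Consecutive dyadic approximations of [t] are thus equal or neighbours on the finer level, and
    increments between neighbours are the ones that [step] controls. *)
Lemma trunc_dyadicS (n : nat) (t : R) : 0 <= t ->
  Num.truncn (t * 2 ^+ n.+1) = (Num.truncn (t * 2 ^+ n)).*2 \/
  Num.truncn (t * 2 ^+ n.+1) = (Num.truncn (t * 2 ^+ n)).*2.+1.
Proof.
move=> t0; have x0 : 0 <= t * 2 ^+ n by rewrite mulr_ge0// ltW.
have -> : t * 2 ^+ n.+1 = 2 * (t * 2 ^+ n) by rewrite exprS; ring.
move: (t * 2 ^+ n) x0 => x x0; have /andP[h1 h2] := truncn_itv x0.
set m := Num.truncn x in h1 h2 *.
have [h3|h3] := ltP (2 * x) (m.*2.+1)%:R.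
  left; apply: truncn_def; rewrite h3 andbT -muln2 natrM; lra.
right; apply: truncn_def; rewrite h3/= -doubleS -muln2 natrM; lra.
Qed.

Variables (g : R -> R) (nu1 nu2 q : R) (n0 : nat).
Hypotheses (nu1_ge0 : 0 <= nu1) (q_gt0 : 0 < q) (q_lt1 : q < 1).
Hypothesis step : forall n k, (n0 <= n)%N ->
  nu1 <= dyadic n k -> dyadic n k.+1 <= nu2 ->
  `|g (dyadic n k.+1) - g (dyadic n k)| <= q ^+ n.

Let qn_ge0 n : 0 <= q ^+ n. Proof. by rewrite exprn_ge0// ltW. Qed.

Let chain_level n k j : (n0 <= n)%N -> nu1 <= dyadic n k ->
  dyadic n (k + j) <= nu2 -> `|g (dyadic n (k + j)) - g (dyadic n k)| <= j%:R * q ^+ n.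
Proof.
move=> n0n nu1k; elim: j => [|j IH] kj2; first by rewrite addn0 subrr normr0 mul0r.
rewrite addnS in kj2 *.
have kj2' : dyadic n (k + j) <= nu2.
  by apply: le_trans kj2; rewrite ler_dyadic.
have nu1kj : nu1 <= dyadic n (k + j).
  by apply: (le_trans nu1k); rewrite ler_dyadic leq_addr.
have h1 := IH kj2'; have h2 := step n0n nu1kj kj2.
rewrite (_ : _ - _ = (g (dyadic n (k + j).+1) - g (dyadic n (k + j))) +
   (g (dyadic n (k + j)) - g (dyadic n k))); last by ring.
apply: (le_trans (ler_normD _ _)); rewrite -natr1 mulrDl mul1r; lra.
Qed.

(** In the chaining, [t2] is approached from below by [lo] and [t1] from above by [up], so that
    every dyadic point used stays between [t1] and [t2], where [step] applies. *)
Let lo n (t : R) := dyadic n (Num.truncn (t * 2 ^+ n)) : R.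
Let up n (t : R) := dyadic n (Num.truncn (t * 2 ^+ n)).+1 : R.

Let chain_lo n t : (n0 <= n)%N -> 0 <= t -> nu1 <= lo n t -> t <= nu2 ->
  nu1 <= lo n.+1 t /\ `|g (lo n.+1 t) - g (lo n t)| <= q ^+ n.+1.
Proof.
move=> n0n t0 nu1t tnu2; have le2 := dyadic_trunc_le n.+1 t0.
rewrite /lo [dyadic n _]dyadicS in nu1t *.
have [E|E] := trunc_dyadicS n t0; rewrite E in le2 *.
  by rewrite subrr normr0.
split; first by apply: (le_trans nu1t); rewrite ler_dyadic.
by apply: step => //; [exact: leqW|exact: le_trans tnu2].
Qed.

Let chain_up n t : (n0 <= n)%N -> 0 <= t -> nu1 <= t -> up n t <= nu2 ->
  up n.+1 t <= nu2 /\ `|g (up n.+1 t) - g (up n t)| <= q ^+ n.+1.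
Proof.
move=> n0n t0 nu1t tnu2; have lt2 := dyadic_trunc_gt n.+1 t.
rewrite /up [dyadic n _]dyadicS doubleS in tnu2 *.
have [E|E] := trunc_dyadicS n t0; rewrite E in lt2 *.
  split; first by apply: le_trans tnu2; rewrite ler_dyadic.
  rewrite distrC; apply: step => //; first exact: leqW.
  by rewrite (le_trans nu1t)// ltW.
by rewrite subrr normr0.
Qed.

Let half_lt e : 0 < e -> exists n0, forall n, (n0 <= n)%N -> (2 ^- n : R) < e.
Proof.
move=> e0; have half1 : `|2^-1 : R| < 1 by rewrite ger0_norm; lra.
have /cvgrPdist_lt/(_ _ e0)[n _ Hn] := cvg_expr half1.
exists n => m nm; have := Hn m nm.
by rewrite sub0r normrN ger0_norm ?exprn_ge0// exprVn.
Qed.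

(** In the constant, [2 * 2 ^+ n0] bounds the number of steps of level [n] from [up n t1] to
    [lo n t2], and [2 / (1 - q)] accounts for the two geometric tails from there to [t1] and
    [t2]. *)
Lemma dyadic_chaining : {within `[nu1, nu2], continuous g} ->
  forall t1 t2, nu1 <= t1 -> t1 < t2 -> t2 <= nu2 -> t2 - t1 <= 1 ->
  exists2 n : nat, 2 ^- n <= t2 - t1 &
    `|g t2 - g t1| <= (2 * 2 ^+ n0 + 2 / (1 - q)) * q ^+ n.
Proof.
move=> gc t1 t2 nut1 t12 tnu2 h1.
have t10 : 0 <= t1 := le_trans nu1_ge0 nut1.
have t20 : 0 <= t2 := le_trans t10 (ltW t12).
have h0 : 0 < t2 - t1 by rewrite subr_gt0.
have exN : exists N, 2 ^- N <= t2 - t1.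
  by have [N HN] := half_lt h0; exists N; exact/ltW/HN.
pose N := ex_minn exN.
have [N1 N2] : 2 ^- N <= t2 - t1 /\ t2 - t1 < 2 * 2 ^- N.
  rewrite /N; case: ex_minnP => M HM Mmin; split => //.
  case: M HM Mmin => [|M] HM Mmin; first by rewrite expr0; lra.
  rewrite exprS invfM mulrA divff// mul1r ltNge; apply/negP => /Mmin.
  by rewrite ltnn.
(* The natural level is [N], but [step] is available only from level [n0] on; since [n <= N + n0],
   going finer multiplies the number of steps by at most [2 ^+ n0]. *)
pose n := maxn N n0.
have n0n : (n0 <= n)%N by rewrite leq_maxr.
have nh : 2 ^- n <= t2 - t1.
  by apply: le_trans N1; rewrite lef_pV2 ?posrE// ler_weXn2l ?ler1n// leq_maxl.
exists n => //.
pose m1 := Num.truncn (t1 * 2 ^+ n); pose m2 := Num.truncn (t2 * 2 ^+ n).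
have /andP[b1 b2] := @truncn_itv _ (t1 * 2 ^+ n) (mulr_ge0 t10 (ltW (pow2_gt0 n))).
have /andP[c1 c2] := @truncn_itv _ (t2 * 2 ^+ n) (mulr_ge0 t20 (ltW (pow2_gt0 n))).
have hn : 1 <= (t2 - t1) * 2 ^+ n by rewrite -ler_pdivrMr// mul1r.
have hn2 : (t2 - t1) * 2 ^+ n <= 2 * 2 ^+ n0.
  apply: (@le_trans _ _ (2 * 2 ^- N * 2 ^+ n)); first by rewrite ler_wpM2r// ltW.
  rewrite -mulrA ler_wpM2l// ler_pdivrMl// -exprD ler_weXn2l ?ler1n//.
  by rewrite geq_max leq_addr leq_addl.
have m12 : (m1.+1 <= m2)%N.
  rewrite truncn_ge_nat ?(mulr_ge0 t20 (ltW (pow2_gt0 n)))// -natr1.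
  rewrite /m1; lra.
have level0 : `|g (lo n t2) - g (up n t1)| <= 2 * 2 ^+ n0 * q ^+ n.
  have -> : lo n t2 = dyadic n (m1.+1 + (m2 - m1.+1)) by rewrite subnKC.
  apply: (le_trans (chain_level n0n _ _)).
  - by rewrite (le_trans nut1)// ltW// dyadic_trunc_gt.
  - by rewrite subnKC// (le_trans _ tnu2)// dyadic_trunc_le.
  - rewrite ler_wpM2r// natrB// -natr1 /m1 /m2; lra.
have up0 : up n t1 <= nu2.
  apply: (@le_trans _ _ (lo n t2)); first by rewrite ler_dyadic.
  by rewrite (le_trans _ tnu2)// dyadic_trunc_le.
have lo0 : nu1 <= lo n t2.
  apply: (@le_trans _ _ (up n t1)); last by rewrite ler_dyadic.
  by rewrite (le_trans nut1)// ltW// dyadic_trunc_gt.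
(* The last term is the closed form of twice the sum of [q ^+ i] for [n <= i < n + j]; each
   refinement costs at most [2 * q ^+ (n + j).+1]. *)
have levels j : [/\ up (n + j) t1 <= nu2, nu1 <= lo (n + j) t2 &
    `|g (lo (n + j) t2) - g (up (n + j) t1)| <=
      2 * 2 ^+ n0 * q ^+ n + 2 / (1 - q) * (q ^+ n - q ^+ (n + j))].
  elim: j => [|j [u1 l1 IH]]; first by rewrite addn0 subrr mulr0 addr0.
  have n0j : (n0 <= n + j)%N by rewrite (leq_trans n0n)// leq_addr.
  have [l2 L] := chain_lo n0j t20 l1 tnu2.
  have [u2 U] := chain_up n0j t10 nut1 u1.
  rewrite addnS; split => //.
  rewrite (_ : _ - _ = (g (lo (n + j).+1 t2) - g (lo (n + j) t2)) +
    ((g (lo (n + j) t2) - g (up (n + j) t1)) -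
    (g (up (n + j).+1 t1) - g (up (n + j) t1)))); last by ring.
  apply: (le_trans (ler_normD _ _)).
  apply: (le_trans (lerD (lexx _) (ler_normB _ _))).
  have E : 2 / (1 - q) * (q ^+ n - q ^+ (n + j).+1) =
     2 / (1 - q) * (q ^+ n - q ^+ (n + j)) + 2 * q ^+ (n + j).
    by rewrite exprS; field; rewrite gt_eqF// subr_gt0.
  have : q ^+ (n + j).+1 <= q ^+ (n + j) by rewrite exprS ler_piMl// ltW.
  rewrite E; lra.
(* The approximations need not reach [t1] and [t2]; continuity at these two points closes the gap,
   at a cost of [e / 2] each. *)
apply/ler_addgt0Pr => e e0.
have e2 : 0 < e / 2 by rewrite divr_gt0.
have s1 : [set` `[nu1, nu2]] t1 by rewrite /= in_itv/= nut1/= (le_trans (ltW t12)).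
have s2 : [set` `[nu1, nu2]] t2 by rewrite /= in_itv/= tnu2 andbT (le_trans nut1)// ltW.
have [r1 r10 H1] := within_continuous_dist gc s1 e2.
have [r2 r20 H2] := within_continuous_dist gc s2 e2.
have r0 : 0 < Num.min r1 r2 by rewrite lt_min r10.
have [j0 Hj] := half_lt r0.
have := Hj (n + j0)%N (leq_addl _ _); rewrite lt_min => /andP[jr1 jr2].
have [u1 l1 L] := levels j0.
have d1 : `|t1 - up (n + j0) t1| < r1.
  apply: le_lt_trans jr1; rewrite distrC ger0_norm; last first.
    by rewrite subr_ge0 ltW// dyadic_trunc_gt.
  rewrite lerBlDr /up /dyadic -natr1 mulrDl mul1r addrC lerD2l.
  exact: dyadic_trunc_le.
have d2 : `|t2 - lo (n + j0) t2| < r2.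
  apply: le_lt_trans jr2; rewrite ger0_norm; last first.
    by rewrite subr_ge0 dyadic_trunc_le.
  rewrite lerBlDr; apply: (le_trans (ltW (dyadic_trunc_gt (n + j0) t2))).
  by rewrite /lo /dyadic -natr1 mulrDl mul1r addrC.
have i1 : [set` `[nu1, nu2]] (up (n + j0) t1).
  by rewrite /= in_itv/= u1 andbT (le_trans nut1)// ltW// dyadic_trunc_gt.
have i2 : [set` `[nu1, nu2]] (lo (n + j0) t2).
  by rewrite /= in_itv/= l1 (le_trans _ tnu2)// dyadic_trunc_le.
have {H1 d1} H1 := H1 _ i1 d1; have {H2 d2} H2 := H2 _ i2 d2.
rewrite (_ : g t2 - g t1 = (g t2 - g (lo (n + j0) t2)) +
  ((g (lo (n + j0) t2) - g (up (n + j0) t1)) - (g t1 - g (up (n + j0) t1)))); last by ring.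
apply: (le_trans (ler_normD _ _)).
apply: (le_trans (lerD (lexx _) (ler_normB _ _))).
have K : 2 / (1 - q) * (q ^+ n - q ^+ (n + j0)) <= 2 / (1 - q) * q ^+ n.
  by rewrite ler_wpM2l ?divr_ge0 ?subr_ge0 ?(ltW q_lt1)// gerBl.
lra.
Qed.

End dyadic_chaining.

(** * Borel-Cantelli and conclusion *)

Lemma expRN_le_pow {R : realType} (x : R) (m : nat) : 0 < x ->
  expR (- x) <= m.+1`!%:R / x ^+ m.+1.
Proof.
move=> x0; rewrite expRN -[leRHS]invf_div lef_pV2 ?posrE ?expR_gt0//; last first.
  by rewrite divr_gt0 ?exprn_gt0// ltr0n fact_gt0.
by have := expR_ge1Dxn m (ltW x0); lra.
Qed.

(** With [m] such that [4 <= z ^+ m.+1], bounding the exponential by a power of order [m.+1] leaves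
    at most a multiple of [2 ^+ n / 4 ^+ n]. *)
Lemma exp_pow_summable {R : realType} (z c : R) : 1 < z -> 0 < c ->
  (\sum_(n <oo) (2 ^+ n * (2 * expR (- (z ^+ n * c))))%:E < +oo)%E.
Proof.
move=> z1 c0; have z0 : 0 < z by lra.
have [m Hm] : exists m : nat, 4 <= z ^+ m.+1.
  have zV : `|z^-1| < 1 by rewrite ger0_norm ?invr_ge0 ?(ltW z0)// invf_lt1.
  have e4 : 0 < (4^-1 : R) by lra.
  have /cvgrPdist_lt/(_ _ e4)[n _ /(_ n.+1 (leqnSn n))] := cvg_expr zV.
  rewrite sub0r normrN ger0_norm ?exprn_ge0 ?invr_ge0 ?(ltW z0)// exprVn => H.
  by exists n; move: H; rewrite ltf_pV2 ?posrE ?exprn_gt0//; exact: ltW.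
pose K : R := 2 * (m.+1`!%:R / c ^+ m.+1).
have K0 : 0 < K by rewrite mulr_gt0// divr_gt0 ?exprn_gt0// ltr0n fact_gt0.
apply: (@le_lt_trans _ _ (\sum_(n <oo) (geometric K 2^-1 n)%:E)%E).
  apply: lee_nneseries => n _.
    by rewrite lee_fin !mulr_ge0// ?exprn_ge0 ?expR_ge0.
  rewrite lee_fin /geometric/=.
  have zc0 : 0 < z ^+ n * c by rewrite mulr_gt0// exprn_gt0.
  apply: (@le_trans _ _ (2 ^+ n * (2 * (m.+1`!%:R / (z ^+ n * c) ^+ m.+1)))).
    by rewrite !ler_wpM2l ?exprn_ge0// expRN_le_pow.
  rewrite exprMn -exprM mulnC exprM.
  have -> : 2 ^+ n * (2 * (m.+1`!%:R / ((z ^+ m.+1) ^+ n * c ^+ m.+1))) =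
      K * (2 ^+ n / (z ^+ m.+1) ^+ n).
    by rewrite /K invfM; field; rewrite ?gt_eqF ?exprn_gt0// exprn_gt0.
  rewrite ler_wpM2l ?(ltW K0)// -expr_div_n; apply: lerXn2r; rewrite ?nnegrE.
  - by rewrite divr_ge0// exprn_ge0// ltW.
  - lra.
  - by rewrite ler_pdivrMr ?exprn_gt0//; lra.
rewrite (_ : \sum_(_ <= _ <oo) _ = (K * (1 - 2^-1)^-1)%:E)%E ?ltry//.
apply/cvg_lim => //.
rewrite (_ : (fun n => _) = EFin \o series (geometric K 2^-1)); last first.
  by apply/funext => n; rewrite /series/= sumEFin.
apply: cvg_EFin; first by apply: nearW.
by apply: cvg_geometric_series; rewrite ger0_norm; lra.
Qed.

Lemma le_holder_exponent {R : realType} (f : R -> R) (nu1 nu2 beta C : R) :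
  0 <= beta <= 1 ->
  (forall t1 t2, nu1 <= t1 -> t1 < t2 -> t2 <= nu2 ->
    `|f t2 - f t1| <= C * (t2 - t1) `^ beta) ->
  beta <= holder_exponent f nu1 nu2.
Proof.
(* The bound by 1 is what makes the real [sup] a genuine upper bound of the set. *)
move=> beta01 fC; apply: ub_le_sup; first by exists 1 => x [/andP[]].
split=> //; apply: (@le_lt_trans _ _ C%:E); last exact: ltry.
apply: ge_ereal_sup => _ [t1 [t2 [+ + neq ->]]].
wlog t12 : t1 t2 neq / t1 < t2.
  move=> H; have [lt12|lt21|/eqP] := ltgtP t1 t2; first exact: H.
    by move=> h1 h2; rewrite distrC (distrC t2); apply: H => //; rewrite eq_sym.
  by rewrite (negbTE neq).
rewrite !in_itv/= => /andP[h1 h2] /andP[h3 h4].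
have t0 : 0 < t2 - t1 by rewrite subr_gt0.
by rewrite (gtr0_norm t0) lee_fin ler_pdivrMr ?powR_gt0// fC.
Qed.

Section dyadic_increments.
Context {d : measure_display} {Omega : measurableType d} {R : realType}.
Variables (P : probability Omega R) (B : R -> {RV P >-> R}).
Hypothesis hB : standard_brownian_motion B.
Variables (H : R -> R -> Omega -> R) (X : R -> {RV P >-> R}).
Hypothesis X_ito : forall t : R, t \in `[0, 1] -> is_ito_integral B (H t) (X t).

Let energy t1 t2 w : \bar R :=
  (\int[lebesgue_measure]_(s in `[0%R, 1%R]) ((H t2 s w - H t1 s w) ^+ 2)%:E)%E.

Lemma dyadic_unit (n k : nat) : (k <= 2 ^ n)%N -> dyadic n k \in `[0 : R, 1].
Proof.
move=> kn; rewrite in_itv/= divr_ge0//= ler_pdivrMr ?exprn_gt0// mul1r.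
by rewrite -natrX ler_nat.
Qed.

(** A union bound over the [2 ^ n] increments of level [n], followed by Borel-Cantelli. The energy
    condition stays inside the conclusion because it may fail on a path where [A] is small. *)
Lemma dyadic_increments_ae (beta b C : R) : 0 < C -> beta < b ->
  {ae P, forall w, exists n0, forall n k, (n0 <= n)%N -> (k < 2 ^ n)%N ->
    (\int[lebesgue_measure]_(s in `[0%R, 1%R])
      ((H (dyadic n k.+1) s w - H (dyadic n k) s w) ^+ 2)%:E
        <= (C * (2 ^- n) `^ (2 * b))%:E)%E ->
    `|X (dyadic n k.+1) w - X (dyadic n k) w| <= (2^-1 `^ beta) ^+ n}.
Proof.
move=> C0 bb.
pose x n : R := (2^-1 `^ beta) ^+ n; pose y n : R := C * (2 ^- n) `^ (2 * b).
have x0 n : 0 < x n by rewrite exprn_gt0// powR_gt0.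
have y0 n : 0 < y n by rewrite mulr_gt0// powR_gt0// invr_gt0 exprn_gt0.
pose S n k := [set w | (x n <= `|X (dyadic n k.+1) w - X (dyadic n k) w|)%R /\
  (energy (dyadic n k) (dyadic n k.+1) w <= (y n)%:E)%E].
have ito n k : (k < 2 ^ n)%N ->
    is_ito_integral B (H (dyadic n k)) (X (dyadic n k)) /\
    is_ito_integral B (H (dyadic n k.+1)) (X (dyadic n k.+1)).
  by move=> kn; split; apply/X_ito/dyadic_unit => //; exact: ltnW.
have mS n k : (k < 2 ^ n)%N -> measurable (S n k).
  move=> /ito[i1 i2].
  rewrite [S n k](_ : _ =
    [set w | x n <= `|X (dyadic n k.+1) w - X (dyadic n k) w|] `&`
    [set w | (energy (dyadic n k) (dyadic n k.+1) w <= (y n)%:E)%E])//.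
  apply: measurableI; rewrite -[X in measurable X]setTI.
    by apply: measurable_fun_le => //; apply: measurableT_comp => //; exact: measurable_funB.
  apply: emeasurable_fun_infty_c => //.
  exact: (measurable_increment_energy i1 i2).
pose F n := \big[setU/set0]_(k < 2 ^ n) S n k.
have mF n : measurable (F n) by apply: bigsetU_measurable => k _; exact: mS.
(* [x n ^+ 2 / y n] equals [z ^+ n / C], and [z] exceeds 1 because [beta < b]. *)
pose z : R := (2^-1 `^ (2 * (b - beta)))^-1.
have z1 : 1 < z.
  by rewrite /z invf_gt1 ?powR_gt0// powR_half_lt1// mulr_gt0// subr_gt0.
have PF n : (P (F n) <= (2 ^+ n * (2 * expR (- (z ^+ n * (72 * C)^-1))))%:E)%E.
  apply: (le_trans (@Boole_inequality _ _ _ P (S n) (2 ^ n) _)).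
    by move=> k kn; exact: mS.
  apply: (@le_trans _ _ (\sum_(k < 2 ^ n) (2 * expR (- (z ^+ n * (72 * C)^-1)))%:E)%E).
    apply: lee_sum => k _; have [i1 i2] := ito n k (ltn_ord k).
    rewrite (_ : z ^+ n * (72 * C)^-1 = x n ^+ 2 / (72 * y n)).
      exact: (ito_increment_tail hB i1 i2 (x0 n) (y0 n)).
    rewrite /y; have -> : (2 ^- n) `^ (2 * b) = (2^-1 `^ (2 * b)) ^+ n.
      by rewrite -exprVn -powR_mulrn// powRAC powR_mulrn ?powR_ge0.
    have E : (2^-1 : R) `^ (2 * b) = (2^-1 `^ beta) ^+ 2 * 2^-1 `^ (2 * (b - beta)).
      rewrite sqr_powR// (powR_splitB (2 * b) (2 * beta))//.
      by congr (_ * _ `^ _); ring.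
    rewrite E /x /z exprMn exprVn exprAC.
    have U0 : 0 < (2^-1 `^ beta) ^+ n := x0 n.
    have V0 : 0 < (2^-1 `^ (2 * (b - beta)) : R) ^+ n by rewrite exprn_gt0// powR_gt0.
    move: U0 V0; set U := (2^-1 `^ beta) ^+ n; set V := _ ^+ n => U0 V0.
    by field; rewrite !gt_eqF.
  by rewrite sumEFin lee_fin sumr_const card_ord -[leLHS]mulr_natl natrX.
have : P (lim_sup_set F) = 0%E.
  apply: lim_sup_set_cvg0 => //.
  apply: le_lt_trans (exp_pow_summable z1 (_ : 0 < (72 * C)^-1)).
    by apply: lee_nneseries => n *; [exact: measure_ge0|exact: PF].
  by rewrite invr_gt0 mulr_gt0.
move=> PF0.
exists (lim_sup_set F); split => //.
  by apply: bigcap_measurable => // n _; exact: bigcup_measurable.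
move=> w /= nQ n _; apply: contrapT => nF; apply: nQ; exists n => N k nN kN energy_le.
rewrite leNgt; apply/negP => /ltW xX; apply: nF; exists N => //.
by rewrite /F -bigcup_mkord; exists k.
Qed.

End dyadic_increments.

Lemma expr_half {R : realType} (n : nat) (beta : R) :
  (2^-1 `^ beta) ^+ n = (2 ^- n) `^ beta.
Proof. by rewrite -exprVn -(@powR_mulrn _ 2^-1)// powRAC powR_mulrn ?powR_ge0. Qed.

Theorem theorem3p1 (d : measure_display) (Omega : measurableType d)
  (R : realType) (P : probability Omega R)
  (Pcomplete : measure_is_complete P)
  (B : R -> {RV P >-> R}) (hB : standard_brownian_motion B)
  (A : R -> {RV P >-> R}) (a_lo a_hi : R)
  (ha_lo : 2^-1 < a_lo) (ha : a_lo <= a_hi) (ha_hi : a_hi < 1)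
  (A_continuous : forall w, {within `[0, 1], continuous (fun s : R => A s w)})
  (A_adapted : adapted B A)
  (A_range : forall (s : R) w, s \in `[0, 1] -> a_lo <= A s w <= a_hi)
  (c rho : R) (hc : 0 < c) (hrho0 : 0 < rho) (hrho1 : rho <= 1)
  (A_L2 : forall x y : R, x \in `[0, 1] -> y \in `[0, 1] ->
    ('E_P[fun w => (`|A x w - A y w| ^+ 2)%R]
       <= (c * `|x - y| `^ (2 * rho))%:E)%E)
  (gamma : R) (hgamma0 : 2^-1 < gamma) (hgamma1 : gamma < 1)
  (Omega0 : set Omega) (mOmega0 : measurable Omega0) (POmega0 : P Omega0 = 1%E)
  (A_holder : forall w, Omega0 w -> exists C1 : R,
    forall s' s'' : R, s' \in `[0, 1] -> s'' \in `[0, 1] ->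
      `|A s'' w - A s' w| <= C1 * `|s'' - s'| `^ gamma)
  (X : R -> {RV P >-> R})
  (X_ito : forall t : R, t \in `[0, 1] ->
    is_ito_integral B (fun s w => pos_powR (t - s) (A s w - 2^-1)) (X t))
  (X_continuous : forall w, {within `[0, 1], continuous (fun t : R => X t w)}) :
  exists Omega1 : set Omega,
    [/\ measurable Omega1, P Omega1 = 1%E &
      forall w, Omega1 w ->
      forall nu1 nu2 : R, 0 <= nu1 -> nu1 < nu2 -> nu2 <= 1 ->
        inf [set A s w | s in `[nu1, nu2]]
          <= holder_exponent (fun t : R => X t w) nu1 nu2].
Proof.
pose H (t s : R) w := pos_powR (t - s) (A s w - 2^-1).
(* The triple holds [beta], [b] and an integer whose successor plays the role of [C]. Triples being
   countable, they are enumerated by [unpickle] and share one null set. *)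
pose good (p : rat * rat * nat) w := ratr p.1.1 < ratr p.1.2 :> R ->
  exists n0, forall n k, (n0 <= n)%N -> (k < 2 ^ n)%N ->
    (\int[lebesgue_measure]_(s in `[0%R, 1%R])
      ((H (dyadic n k.+1) s w - H (dyadic n k) s w) ^+ 2)%:E
        <= (p.2.+1%:R * (2 ^- n) `^ (2 * ratr p.1.2))%:E)%E ->
    `|X (dyadic n k.+1) w - X (dyadic n k) w| <= (2^-1 `^ ratr p.1.1) ^+ n.
have : {ae P, forall w, forall m, if unpickle m is Some p then good p w else True}.
  apply: ae_foralln => m; case: (unpickle m) => [p|]; last exact: aeW.
  have [lt12|/negP nlt] := boolP (ratr p.1.1 < ratr p.1.2 :> R); last first.
    by apply: aeW => w.
  have C0 : 0 < p.2.+1%:R :> R by rewrite ltr0n.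
  have := dyadic_increments_ae hB X_ito C0 lt12.
  by apply: filterS => w Hw _.
move=> [N [mN PN subN]].
exists (~` N); split.
- exact: measurableC.
- by rewrite probability_setC// PN sube0.
move=> w Nw nu1 nu2 nu10 nu12 nu21.
have {subN Nw} goodw p : good p w.
  have := contra_not (subN w) Nw => /contrapT/(_ (pickle p)).
  by rewrite pickleK.
set mu := inf _; set h := holder_exponent _ _ _.
have mu_le s : nu1 <= s <= nu2 -> mu <= A s w.
  move=> s12; apply: ge_inf; last by exists s => //; rewrite /= in_itv.
  exists a_lo => _ [r r12 <-]; move: r12; rewrite /= in_itv/= => /andP[r1 r2].
  by have /andP[] : a_lo <= A r w <= a_hi by apply: A_range; rewrite in_itv/=; lra.
have Anu s : 0 <= s <= 1 -> 2^-1 <= A s w <= 1.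
  move=> s01; have /andP[] : a_lo <= A s w <= a_hi by apply: A_range; rewrite in_itv.
  lra.
have mu_lo : 2^-1 < mu.
  apply: (lt_le_trans ha_lo); apply: lb_le_inf.
    by exists (A nu1 w), nu1 => //; rewrite /= in_itv/= lexx ltW.
  move=> _ [r r12 <-]; move: r12; rewrite /= in_itv/= => /andP[r1 r2].
  by have /andP[] : a_lo <= A r w <= a_hi by apply: A_range; rewrite in_itv/=; lra.
have mu_hi : mu <= 1.
  apply: (le_trans (mu_le nu1 _)); first by rewrite lexx ltW.
  by have /andP[] : 2^-1 <= A nu1 w <= 1 by apply: Anu; lra.
(* If the exponent [h] were below [mu], rationals with [h < beta < b < mu] could be inserted, and
   regularity of order [beta] would contradict [h < beta]. Keeping both above one half meets the
   requirement of the kernel estimate on [b] and makes [beta] positive. *)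
rewrite leNgt; apply/negP => h_mu.
have : Num.max h 2^-1 < mu by rewrite gt_max h_mu.
move=> /rat_in_itvoo[bq]; rewrite in_itv/= gt_max => /andP[/andP[hb b12] bmu].
have : Num.max h 2^-1 < ratr bq by rewrite gt_max hb.
move=> /rat_in_itvoo[betaq]; rewrite in_itv/= gt_max => /andP[/andP[hbeta beta12] betab].
pose b : R := ratr bq; pose beta : R := ratr betaq.
rewrite -/b in b12 bmu betab; rewrite -/beta in hbeta beta12 betab.
pose a := (b + mu) / 2.
have ba : b < a by rewrite /a; lra.
have a_mu : a < mu by rewrite /a; lra.
(* The kernel estimate looks back by [delta], possibly to the left of [nu1], where [mu] says
   nothing; since [a < mu], continuity of [A] at [nu1] keeps [A] above [a] there. *)
have [delta delta0 a_le] : exists2 delta, 0 < delta &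
    forall s, 0 <= s <= 1 -> nu1 - delta <= s -> s <= nu2 -> a <= A s w.
  have nu1_01 : [set` `[0 : R, 1]] nu1 by rewrite /= in_itv/=; lra.
  have mua : 0 < mu - a by lra.
  have [r r0 Hr] := within_continuous_dist (A_continuous w) nu1_01 mua.
  exists (r / 2); first by rewrite divr_gt0.
  move=> s s01 s1 s2; have [nu1s|snu1] := leP nu1 s.
    by apply: (le_trans (ltW a_mu)); apply: mu_le; rewrite nu1s.
  have := Hr s; rewrite /= in_itv/= s01 => /(_ isT).
  rewrite ger0_norm; last by lra.
  have sr : nu1 - s < r by lra.
  move=> /(_ sr); rewrite ltr_norml => /andP[_].
  have : mu <= A nu1 w by apply: mu_le; rewrite lexx ltW.
  lra.
have a1 := le_trans (ltW a_mu) mu_hi.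
have [C C0 HC] := kernel_increment_energy (ltW b12) ba a1 delta0.
pose c' := Num.truncn C.
have Cc' : C <= c'.+1%:R by apply/ltW/truncnS_gt.
have [n0 Hn0] := goodw (betaq, bq, c') betab.
have step n k : (n0 <= n)%N -> nu1 <= dyadic n k -> dyadic n k.+1 <= nu2 ->
    `|X (dyadic n k.+1) w - X (dyadic n k) w| <= (2^-1 `^ beta) ^+ n.
  move=> nn0 k1 k2.
  have d12 : dyadic n k.+1 - dyadic n k = 2 ^- n :> R.
    by rewrite /dyadic -natr1; ring.
  have n2 : 0 < 2 ^- n :> R by rewrite invr_gt0 exprn_gt0.
  have kn : (k < 2 ^ n)%N.
    move: (le_trans k2 nu21); rewrite /dyadic ler_pdivrMr ?exprn_gt0// mul1r.
    by rewrite -natrX ler_nat.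
  apply: Hn0 => //=.
  have := HC (fun s => A s w) (dyadic n k) (dyadic n k.+1).
  rewrite d12 => HCk; apply: (le_trans (HCk _ _ _ _ _ _)).
  - have ito1 : dyadic n k \in `[0 : R, 1] by apply: dyadic_unit; exact: ltnW.
    have ito2 : dyadic n k.+1 \in `[0 : R, 1] by exact: dyadic_unit.
    have [m1 _ _] := X_ito _ ito1; have [m2 _ _] := X_ito _ ito2.
    exact: measurable_funB (measurable_slice m2 w) (measurable_slice m1 w).
  - exact: Anu.
  - exact: le_trans k1.
  - by rewrite -subr_gt0 d12.
  - exact: le_trans nu21.
  - move=> s s01 s1 s2; apply: a_le => //; last exact: le_trans (ltW s2) k2.
    exact: le_trans (lerB k1 (lexx _)) s1.
  - by rewrite lee_fin ler_wpM2r ?powR_ge0.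
have q0 : 0 < 2^-1 `^ beta :> R by rewrite powR_gt0.
have beta0 : 0 < beta by apply: lt_trans beta12; rewrite invr_gt0.
have q1 : 2^-1 `^ beta < 1 :> R by exact: powR_half_lt1.
have Xc : {within `[nu1, nu2], continuous (fun t => X t w)}.
  apply: continuous_subspaceW (X_continuous w) => s /=.
  rewrite !in_itv/= => /andP[s1 s2].
  by rewrite (le_trans nu10 s1) (le_trans s2 nu21).
have beta01 : 0 <= beta <= 1.
  by rewrite (ltW beta0)/= (le_trans (ltW betab))// (le_trans (ltW bmu)).
suff : beta <= h by rewrite leNgt hbeta.
apply: (le_holder_exponent (C := 2 * 2 ^+ n0 + 2 / (1 - 2^-1 `^ beta)) beta01).
move=> t1 t2 t11 t12 t22.
have [|n n_le] := dyadic_chaining nu10 q0 q1 step Xc t11 t12 t22.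
  by rewrite lerBlDr (le_trans t22)// (le_trans nu21)// lerDl (le_trans nu10).
move=> /le_trans; apply; rewrite expr_half; apply: ler_wpM2l.
  by rewrite addr_ge0 ?mulr_ge0 ?exprn_ge0// invr_ge0 subr_ge0 ltW.
have h0 : 0 <= t2 - t1 by rewrite subr_ge0 ltW.
by apply: ge0_ler_powR => //; rewrite ?nnegrE ?invr_ge0 ?exprn_ge0// ltW.
Qed.
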